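(* Let $n\ge 2$ and let $\Gamma$ be a group which acts simply transitively and in a type-rotating way on the vertices of a locally finite thick building of type $\widetilde{A_n}$. Then $\Gamma$ has a symmetric automatic structure consisting of geodesics; in particular, $\Gamma$ is biautomatic.
   Context: Type-rotating: each vertex $v$ of a building $\Delta$ of type $\widetilde{A_n}$ has a type $\tau(v)\in\{0,1,\ldots,n\}$, each chamber having exactly one vertex of each type, where the types are numbered so that, in the Coxeter diagram of type $\widetilde{A_n}$ (a cycle of length $n+1$), $i$ is adjacent to $i\pm1$ mod $n+1$. An automorphism $g$ of $\Delta$ is type-rotating if there is an integer $c$ such that $\tau(gv)=\tau(v)+c \pmod{n+1}$ for every vertex $v$. A group acts in a type-rotating way if each of its elements acts as a type-rotating automorphism. Automatic structures: let $A$ be a finite set of semigroup generators of $\Gamma$ closed under inversion, $A^*$ the set of strings over $A$, and $u\mapsto\bar u$ the evaluation map $A^*\to\Gamma$. Let $d$ be the word metric $d(g,g')=|g^{-1}g'|$, and for $u=u_1\cdots u_\ell\in A^*$ let $u(t)=\overline{u_1\cdots u_t}$ for $0\le t\le \ell$ and $u(t)=\bar u$ for $t>\ell$. A regular language $L\subset A^*$ which maps onto $\Gamma$ is an automatic structure for $\Gamma$ if there is a constant $k$ such that $d(u(t),v(t))\le k$ for all integers $t\ge0$ whenever $u,v\in L$ satisfy $\bar v=\bar u$ or $\bar v=\bar u a$ for some $a\in A$. It is symmetric if moreover $u_1\cdots u_\ell\in L$ implies $u_\ell^{-1}\cdots u_1^{-1}\in L$. It consists of geodesics if every $u_1\cdots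 u_\ell\in L$ has $|\bar u|=\ell$. $\Gamma$ is biautomatic if it has an automatic structure $L$ for which, in addition, there is a constant $k'$ such that $d(u(t),a v(t))\le k'$ for all integers $t\ge0$ whenever $u,v\in L$, $a\in A$ and $\bar u=a\bar v$. *)

(* Defs.v *)
From mathcomp Require Import all_boot.
From mathcomp Require Import finmap boolp classical_sets functions cardinality.

Set Implicit Arguments.
Unset Strict Implicit.
Unset Printing Implicit Defensive.

Local Open Scope classical_set_scope.

(* In a Coxeter matrix m, the entry 0 stands for infinity: the corresponding  *)
(* relator is then the empty word.                                            *)
Definition coxeter_relator r (m : 'I_r -> 'I_r -> nat) (i j : 'I_r) :
  seq 'I_r := flatten (nseq (m i j) [:: i; j]).

(* Since the relators contain the squares of the generators, this congruence  *)
(* on words is the one defining the group < s_i | (s_i s_j)^(m i j) = 1 >.    *)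
Inductive coxeter_equiv r (m : 'I_r -> 'I_r -> nat) :
    seq 'I_r -> seq 'I_r -> Prop :=
| CoxRel u v i j :
    coxeter_equiv m (u ++ coxeter_relator m i j ++ v) (u ++ v)
| CoxRefl u : coxeter_equiv m u u
| CoxSym u v : coxeter_equiv m u v -> coxeter_equiv m v u
| CoxTrans u v w :
    coxeter_equiv m u v -> coxeter_equiv m v w -> coxeter_equiv m u w.

Definition coxeter_system r (m : 'I_r -> 'I_r -> nat) (W : groupType)
    (s : 'I_r -> W) : Prop :=
  (forall w : W, exists u : seq 'I_r, (\prod_(i <- u) s i)%g = w) /\
  (forall u v : seq 'I_r,
     (\prod_(i <- u) s i)%g = (\prod_(i <- v) s i)%g <-> coxeter_equiv m u v).

(* The Coxeter matrix of the affine diagram, a cycle of length n.+1; this is  *)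
(* the right matrix only for n >= 2.                                          *)
Definition affineA n (i j : 'I_n.+1) : nat :=
  if i == j then 1
  else if (j == i.+1 %[mod n.+1]) || (i == j.+1 %[mod n.+1]) then 3 else 2.

(* The empty set is a simplex. The vertices may be a proper subset of the     *)
(* carrier type, so that the subcomplexes of a complex have the same type.    *)
Definition is_complex V (K : set (set V)) : Prop :=
  [/\ K set0,
      forall a, K a -> finite_set a &
      forall a b, K a -> b `<=` a -> K b].

Definition vertices V (K : set (set V)) : set V := [set v | K [set v]].

Definition isomorphism V V' (K : set (set V)) (K' : set (set V'))
    (f : V -> V') : Prop :=
  set_inj (vertices K) f /\ [set f @` a | a in K] = K'.

Definition chamber V (K : set (set V)) (c : set V) : Prop :=
  K c /\ forall d, K d -> c `<=` d -> d = c.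

Definition panel V (K : set (set V)) (p : set V) : Prop :=
  exists c v, [/\ chamber K c, c v & p = c `\ v].

(* The Coxeter complex of (W, S): its vertices are the cosets of the maximal  *)
(* proper standard parabolic subgroups W_(S \ s_i), and the simplex           *)
(* corresponding to a standard coset w W_J has the vertices w W_(S \ s_i) for *)
(* s_i not in J. Hence the simplices are the subsets of the chambers          *)
(* {w W_(S \ s_i) | i}.                                                       *)

Definition parabolic r (W : groupType) (s : 'I_r -> W) (J : pred 'I_r) :
  set W := [set (\prod_(i <- u) s i)%g | u in [set u : seq 'I_r | all J u]].

Definition coxeter_vertex r (W : groupType) (s : 'I_r -> W) (w : W)
    (i : 'I_r) : set W :=
  [set (w * x)%g | x in parabolic s (predC1 i)].

Definition coxeter_complex r (W : groupType) (s : 'I_r -> W) :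
    set (set (set W)) :=
  [set a | exists w, a `<=` range (coxeter_vertex s w)].

(* D is a building of type m with vertex set V, and tau is its type function: *)
(* each apartment is identified with the Coxeter complex so that the vertex   *)
(* w W_(S \ s_i) has type i. In particular each chamber has exactly one       *)
(* vertex of each type, and the numbering of the types is that of the diagram.*)
Definition building r (m : 'I_r -> 'I_r -> nat) V (D : set (set V))
    (tau : V -> 'I_r) : Prop :=
  is_complex D /\ vertices D = setT /\
  exists (W : groupType) (s : 'I_r -> W) (apartments : set (set (set V))),
    [/\ coxeter_system m s,
        forall X, apartments X ->
          [/\ is_complex X, X `<=` D &
              exists f : set W -> V,
                isomorphism (coxeter_complex s) X f /\
                (forall w i, tau (f (coxeter_vertex s w i)) = i)],
        forall a b, D a -> D b -> exists2 X, apartments X & X a /\ X b &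
        forall X Y a b, apartments X -> apartments Y ->
          X a -> X b -> Y a -> Y b ->
          exists f : V -> V,
            isomorphism X Y f /\ (forall v, (a `|` b) v -> f v = v)].

Definition thick V (D : set (set V)) : Prop :=
  forall p, panel D p -> exists c1 c2 c3 : set V,
    [/\ chamber D c1 /\ p `<=` c1, chamber D c2 /\ p `<=` c2,
        chamber D c3 /\ p `<=` c3 & [/\ c1 <> c2, c1 <> c3 & c2 <> c3]].

Definition locally_finite V (D : set (set V)) : Prop :=
  forall v, vertices D v -> finite_set [set a | D a /\ a v].

(* To be used for a complex D of which all elements of V are vertices.        *)
Definition acts_on V (D : set (set V)) (G : groupType) (act : G -> V -> V) :
    Prop :=
  [/\ forall v, act 1%g v = v,
      forall g h v, act (g * h)%g v = act g (act h v) &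
      forall g, isomorphism D D (act g)].

Definition simply_transitive V (G : groupType) (act : G -> V -> V) : Prop :=
  forall x y : V, exists! g, act g x = y.

(* Every integer is congruent mod n.+1 to a natural number, so c is in nat.   *)
Definition type_rotating n V (tau : V -> 'I_n.+1) (f : V -> V) : Prop :=
  exists c : nat, forall v, tau (f v) = tau v + c %[mod n.+1].

(* A string over A is a sequence of elements of T all of whose letters are in *)
(* A; the values of delta at letters outside A play no role.                  *)
Definition regular (T : choiceType) (A : {fset T}) (L : set (seq T)) : Prop :=
  exists (Q : finType) (q0 : Q) (delta : Q -> T -> Q) (F : pred Q),
    forall u, L u <-> all (mem A) u /\ F (foldl delta q0 u).

Section Automatic.
Variables (G : groupType) (A : {fset G}).
Implicit Types (L : set (seq G)) (u v : seq G).

Definition eval u : G := (\prod_(x <- u) x)%g.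

Definition semigroup_generators : Prop :=
  forall g, exists u, [/\ u <> [::], all (mem A) u & eval u = g].

Definition inversion_closed : Prop := forall a, a \in A -> (a^-1)%g \in A.

Definition word_lengths (g : G) : set nat :=
  [set k | exists u, [/\ all (mem A) u, eval u = g & size u = k]].

(* The value 0 is a dummy one when g is not a product of elements of A.       *)
Definition word_length (g : G) : nat :=
  xget 0 [set k | word_lengths g k /\ forall l, word_lengths g l -> k <= l].

Definition word_dist (g h : G) : nat := word_length (g^-1 * h)%g.

(* take t u is u when t exceeds the length of u. *)
Definition prefix_eval u (t : nat) : G := eval (take t u).

Definition automatic_structure L : Prop :=
  [/\ regular A L,
      forall g, exists2 u, L u & eval u = g &
      exists k, forall u v, L u -> L v ->
        (eval v = eval u \/ exists2 a, a \in A & eval v = (eval u * a)%g) ->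
        forall t, word_dist (prefix_eval u t) (prefix_eval v t) <= k].

Definition symmetric_language L : Prop :=
  forall u, L u -> L (rev [seq (x^-1)%g | x <- u]).

Definition geodesic_language L : Prop :=
  forall u, L u -> word_length (eval u) = size u.

Definition biautomatic_structure L : Prop :=
  automatic_structure L /\
  exists k, forall u v a, L u -> L v -> a \in A ->
    eval u = (a * eval v)%g ->
    forall t, word_dist (prefix_eval u t) (a * prefix_eval v t)%g <= k.

End Automatic.

Definition biautomatic (G : groupType) : Prop :=
  exists (A : {fset G}) (L : set (seq G)),
    [/\ semigroup_generators A, inversion_closed A & biautomatic_structure A L].

(* Main.v *)
Require Import Defs.
From mathcomp Require Import all_boot all_order all_algebra zify.
From mathcomp Require Import finmap boolp classical_sets functions cardinality.

Set Implicit Arguments.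
Unset Strict Implicit.
Unset Printing Implicit Defensive.
Import Order.TTheory GRing.Theory Num.Theory.

(** Write m = n + 1. An apartment of type ~A_n is Z^m modulo constant vectors,
    a simplex being a chain p <= q <= ... <= p + 1. Two vertices p and p + d,
    where d >= 0 has minimum 0, are joined by the path p + min (d, t) for
    t = 0, ..., max d. Its steps are the indicator vectors of a decreasing chain
    of sets, and max d is the distance of its ends, since retractions onto the
    apartment do not lengthen paths.

    The key fact is that this path depends on its ends only, not on the
    apartment (chart_pred). Let y be the last vertex before the end x in one
    apartment and y' that in another one, let S and S' be the sets of coordinates
    that the last steps increase, and assume that S has at least the size of S'.
    Retract the building onto the first apartment from a chamber that contains y.
    The image of y' is x minus the indicator vector of a set R which has the size
    of S', by types, and which contains S, as the image is nearer to the origin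
    than x. So R = S and the image is y. But a retraction sends no other vertex
    to a vertex of its central chamber, so y' = y.

    It follows that a path all of whose subpaths of length two are of this form
    is itself of this form (last_stepS, straight_chart): put its origin and its
    next edge in a common apartment, which by the key fact contains the preceding
    vertex too.

    Fix a vertex o, and take as generators the g such that g o is adjacent to o.
    The language consists of the words that spell such a path starting at o.
    It is regular, because it is defined by a condition on pairs of consecutive
    letters. The words are geodesic; the reverse of a path of this form is of
    this form; and every element is reached, as o and g o lie in an apartment.
    Since a vertex and an edge lie in a common apartment, which then contains the
    paths joining them, both fellow-traveller properties are a computation with
    vectors (cap_near). Type-rotating automorphisms transport all this, because
    it is stated in terms of the maps is_chart, whose defining properties they
    preserve.

    It remains to find the coordinates. The Coxeter group W acts on Z by affine
    permutations. That the relations suffice is shown by sorting: two ways of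
    sorting an affine permutation by adjacent swaps give the same element of W
    (sorts_unique). As a consequence W acts faithfully, the parabolic subgroup
    omitting s_j is the stabiliser of {k <= j} (stab_parabolic), and the vertices
    of the Coxeter complex are the vectors modulo constants (loc_vertex,
    chamber_ex). The retractions come from the fact that an isomorphism of
    apartments is determined by its restriction to a chamber (rigidity). *)

(* Premises that are still to the left of an arrow are not seen by lia. *)
Ltac ilia := intros; lia.

(* Case analysis on all conditionals, innermost first. *)
Ltac ifs := intros;
  repeat match goal with H : context [if _ then _ else _] |- _ => revert H end;
  repeat match goal with |- context [if ?b then _ else _] =>
  lazymatch b with
  | context [if _ then _ else _] => fail
  | _ => let h := fresh "hif" in case h: b => /=; try (exfalso; lia)
  end end; try (intros; lia).

(** * Affine permutations of the integers *)

Section AffinePermutations.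
Local Open Scope ring_scope.
Variable n : nat.
Notation m := (n.+1%:Z).
Implicit Types (i j : 'I_n.+1) (k a : int) (f : int -> int).

Lemma res_bound k : 0 <= (k %% m)%Z <= n%:Z.
Proof. by move: (k) => {}k; ilia. Qed.

Lemma res_eq q r : 0 <= r <= n%:Z -> ((q * m + r) %% m)%Z = r.
Proof. by move=> hr; rewrite modzMDl modz_small //; ilia. Qed.

Lemma div_eq q r : 0 <= r <= n%:Z -> ((q * m + r) %/ m)%Z = q.
Proof. by move=> hr; rewrite divzMDl // divz_small ?addr0 //; ilia. Qed.

Lemma resP k : exists q, k = q * m + (k %% m)%Z.
Proof. by exists (k %/ m)%Z; rewrite -divz_eq. Qed.

(** The successor in the cycle of residues 0, ..., n. *)
Definition nxt (x : int) : int := if x == n%:Z then 0 else x + 1.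

Definition shift (i x : int) : int :=
  if x == i then 1 else if x == nxt i then -1 else 0.

(** The action of s_i: it exchanges k and k + 1 for all k congruent to i. *)
Definition swap i k : int := k + shift i%:Z (k %% m)%Z.

(** What swap does to residues; comparing compositions of swaps thus becomes a
    finite case analysis on the residue of the argument. *)
Definition swapr (i x : int) : int := if x == i then nxt i else if x == nxt i then i else x.

Lemma swap_res i k : (swap i k %% m)%Z = swapr i%:Z (k %% m)%Z.
Proof.
have hi := ltn_ord i; rewrite /swap.
have [q {1}->] := resP k; have := res_bound k; move: (k %% m)%Z => x hx.
rewrite /shift /swapr /nxt.
have [e|ne] := eqVneq x i%:Z.
  have [ei|nei] := eqVneq i%:Z n%:Z; last by rewrite -addrA res_eq; ilia.
  by rewrite (_ : _ + 1 = (q + 1) * m + 0) ?res_eq; ilia.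
have [ei|nei] := eqVneq i%:Z n%:Z.
  have [->|nx] := eqVneq x 0; last by rewrite addr0 res_eq.
  by rewrite (_ : _ - 1 = (q - 1) * m + n%:Z) ?res_eq; ilia.
have [->|nx] := eqVneq x (i%:Z + 1); last by rewrite addr0 res_eq.
by rewrite -addrA res_eq; ilia.
Qed.

Lemma swapK (hn : (2 <= n)%N) i k : swap i (swap i k) = k.
Proof.
rewrite {1}/swap swap_res /swap /swapr /shift /nxt.
by have := res_bound k; have := ltn_ord i; move: (k %% m)%Z => x; ifs.
Qed.

Definition adjacent i j := nxt i%:Z = j%:Z.

Lemma swap_comm i j k : i != j -> ~ adjacent i j -> ~ adjacent j i ->
  swap i (swap j k) = swap j (swap i k).
Proof.
rewrite /adjacent -val_eqE /= => ij nij nji.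
rewrite {1}/swap swap_res [in RHS]/swap swap_res /swap /swapr /shift.
have := res_bound k; have := ltn_ord i; have := ltn_ord j; move: nij nji.
by rewrite /nxt; move: (k %% m)%Z => x; ifs.
Qed.

Lemma swap_braid (hn : (2 <= n)%N) i j k : adjacent i j ->
  swap i (swap j (swap i k)) = swap j (swap i (swap j k)).
Proof.
rewrite /adjacent => ij.
have -> : swap i (swap j (swap i k)) = k + shift i%:Z (k %% m)%Z
   + shift j%:Z (swapr i%:Z (k %% m)%Z) + shift i%:Z (swapr j%:Z (swapr i%:Z (k %% m)%Z)).
  by rewrite {1}/swap !swap_res {1}/swap swap_res.
have -> : swap j (swap i (swap j k)) = k + shift j%:Z (k %% m)%Z
   + shift i%:Z (swapr j%:Z (k %% m)%Z) + shift j%:Z (swapr i%:Z (swapr j%:Z (k %% m)%Z)).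
  by rewrite {1}/swap !swap_res {1}/swap swap_res.
have := res_bound k; have := ltn_ord i; have := ltn_ord j; move: ij.
rewrite /swapr /shift /nxt; move: (k %% m)%Z => x; ifs.
Qed.

Definition wact (u : seq 'I_n.+1) k : int := foldr swap k u.

Lemma wact_cat u v k : wact (u ++ v) k = wact u (wact v k).
Proof. by rewrite /wact foldr_cat. Qed.

Lemma affineA_adj i j : i != j ->
  (j == i.+1 %[mod n.+1]) || (i == j.+1 %[mod n.+1]) <-> adjacent i j \/ adjacent j i.
Proof.
have mS (x : 'I_n.+1) : (x.+1 %% n.+1 = if x == n :> nat then 0 else x.+1)%N.
  by case: eqP => [->|ne]; rewrite ?modnn // modn_small //; have := ltn_ord x; ilia.
move=> ij; rewrite /adjacent /nxt !mS !(modn_small (ltn_ord _)).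
split; first by case/orP => /eqP ->; [left|right]; ifs.
by case=> h; apply/orP; [left|right]; apply/eqP; move: h; ifs.
Qed.

Lemma wact_relator (hn : (2 <= n)%N) i j k : wact (coxeter_relator (@affineA n) i j) k = k.
Proof.
rewrite /coxeter_relator /affineA; case: eqVneq => [->|ij] /=; first by rewrite !(swapK hn).
case: ifP => [/affineA_adj|/negP nadj] /=.
  case=> // a; last by rewrite (swap_braid hn _ a) !(swapK hn).
  by rewrite -(swap_braid hn _ a) !(swapK hn).
rewrite (swap_comm k) ?(swapK hn) // => a; apply: nadj; apply/affineA_adj => //; [by left|by right].
Qed.

Lemma wact_equiv (hn : (2 <= n)%N) u v : coxeter_equiv (@affineA n) u v -> wact u =1 wact v.
Proof.
elim=> [u1 v1 i j|u1|u1 v1 _ IH|u1 v1 w1 _ IH1 _ IH2] k //.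
  by rewrite !wact_cat (wact_relator hn).
by rewrite IH1.
Qed.

Definition periodic f := forall k, f (k + m) = f k + m.

Lemma periodicM f q k : periodic f -> f (k + q * m) = f k + q * m.
Proof.
move=> pf; have pos (l : nat) x : f (x + l%:Z * m) = f x + l%:Z * m.
  elim: l x => [|l IH] x; first by rewrite mul0r !addr0.
  by rewrite (_ : x + _ = x + l%:Z * m + m) ?pf ?IH; ilia.
case: q => l; first exact: pos.
have := pos l.+1 (k + Negz l * m).
by rewrite -addrA -mulrDl NegzE addNr mul0r addr0 => ->; rewrite mulNr addrK.
Qed.

Lemma swap_periodic i : periodic (swap i).
Proof. by move=> k; rewrite /swap modzDr; ilia. Qed.

Lemma wact_periodic u : periodic (wact u).
Proof. by elim: u => [|i u IH] k //=; rewrite IH swap_periodic. Qed.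

Lemma window_sum (h : int -> int) a : (forall k, h (k + m) = h k) ->
  \sum_(r < n.+1) h (a + r%:Z) = \sum_(r < n.+1) h r%:Z.
Proof.
move=> ph.
have pos (g : int -> int) (pg : forall k, g (k + m) = g k) (l : nat) :
    \sum_(r < n.+1) g (l%:Z + r%:Z) = \sum_(r < n.+1) g r%:Z.
  elim: l => [|l IH]; first by apply: eq_bigr => r _; rewrite add0r.
  rewrite -IH big_ord_recr big_ord_recl /= addrC; congr (_ + _).
    by rewrite -(pg (l%:Z + 0%N%:Z)); congr g; ilia.
  by apply: eq_bigr => r _; congr g; rewrite /bump; ilia.
case: a => l; first exact: pos.
rewrite -(pos (fun k => h (Negz l + k)) _ l.+1).
  by apply: eq_bigr => r _; congr h; ilia.
by move=> k; rewrite addrA ph.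
Qed.

Lemma sum_two (n' : nat) (g : int -> int) : (0 < n')%N ->
  \sum_(r < n'.+1) g r%:Z = g 0 + g 1 + \sum_(r < n'.-1) g (r%:Z + 2).
Proof.
case: n' => // n' _; rewrite !big_ord_recl /= addrA; congr (_ + _).
by apply: eq_bigr => r _; congr g; rewrite /bump; ilia.
Qed.

Lemma swap_far i (r : nat) : (r < n.-1)%N -> swap i (i%:Z + (r%:Z + 2)) = i%:Z + (r%:Z + 2).
Proof.
move=> hr; have hi := ltn_ord i; rewrite /swap.
have -> : ((i%:Z + (r%:Z + 2)) %% m)%Z =
    if (i + r + 2 < n.+1)%N then i%:Z + r%:Z + 2 else i%:Z + r%:Z + 2 - m.
  case: ifP => h; first by rewrite modz_small; ilia.
  by rewrite -[LHS](modzMDl (-1)) modz_small; ilia.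
by rewrite /shift /nxt; ifs.
Qed.

Lemma swap_at i : swap i i%:Z = i%:Z + 1.
Proof. by rewrite /swap modz_small ?/shift ?eqxx //; have := ltn_ord i; ilia. Qed.

Lemma swap_next (hn : (2 <= n)%N) i : swap i (i%:Z + 1) = i%:Z.
Proof. by rewrite -swap_at (swapK hn). Qed.

(** Periodicity allows the window to start at i, where only the first two
    terms change. *)
Lemma sum_swap (hn : (2 <= n)%N) (F : int -> int -> int) f i :
  (forall k v, F (k + m) (v + m) = F k v) -> periodic f ->
  \sum_(r < n.+1) F r%:Z (f (swap i r%:Z)) + F i%:Z (f i%:Z) + F (i%:Z + 1) (f (i%:Z + 1)) =
  \sum_(r < n.+1) F r%:Z (f r%:Z) + F i%:Z (f (i%:Z + 1)) + F (i%:Z + 1) (f i%:Z).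
Proof.
move=> pF pf.
rewrite -(window_sum (h := fun k => F k (f k)) i%:Z); last first.
  by move=> k; rewrite pf pF.
rewrite -(window_sum (h := fun k => F k (f (swap i k))) i%:Z); last first.
  by move=> k; rewrite swap_periodic pf pF.
have n0 : (0 < n)%N by ilia.
rewrite (sum_two (fun r => F (i%:Z + r) (f (swap i (i%:Z + r)))) n0).
rewrite (sum_two (fun r => F (i%:Z + r) (f (i%:Z + r))) n0) /=.
rewrite addr0 swap_at (swap_next hn).
under eq_bigr => r _ do rewrite swap_far //.
by move: (\sum_(r < _) _) (F _ _) (F _ (f (_ + 1))) => A B C; ilia.
Qed.

(** The vanishing sum excludes the shifts by nonzero constants. *)
Definition affine_perm f :=
  [/\ periodic f, injective f & \sum_(r < n.+1) (f r%:Z - r%:Z) = 0].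

(** A measure that decreases when a descent is undone, by displacement_swap. *)
Definition displacement f : int := \sum_(r < n.+1) (f r%:Z - r%:Z) ^+ 2.

Lemma affine_perm_id : affine_perm id.
Proof. by split=> //; rewrite big1 // => r _; rewrite subrr. Qed.

Lemma affine_perm_swap (hn : (2 <= n)%N) f i : affine_perm f -> affine_perm (f \o swap i).
Proof.
case=> pf jf sf; split.
- by move=> k /=; rewrite swap_periodic pf.
- by move=> k l /= /jf e; rewrite -(swapK hn i k) e (swapK hn).
- have := @sum_swap hn (fun k v => v - k) f i (fun k v => ltac:(lia)) pf.
  rewrite /= sf; move: (\sum_(r < _) _) => S; ilia.
Qed.

Lemma displacement_swap (hn : (2 <= n)%N) f i : periodic f ->
  displacement (f \o swap i) = displacement f - 2 * (f i%:Z - f (i%:Z + 1)).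
Proof.
move=> pf; have e (k v : int) : (v + m - (k + m)) ^+ 2 = (v - k) ^+ 2 by congr (_ ^+ 2); ilia.
have := @sum_swap hn (fun k v => (v - k) ^+ 2) f i e pf.
rewrite /= -/(displacement f) -/(displacement (f \o swap i)) !expr2.
move: (displacement _) (displacement _) (f i%:Z) (f (_ + 1)) => X Y A B; nia.
Qed.

Lemma wact_affine_perm (hn : (2 <= n)%N) u : affine_perm (wact u).
Proof.
elim/last_ind: u => [|u i IH]; first exact: affine_perm_id.
suff -> : wact (rcons u i) = wact u \o swap i by apply: (affine_perm_swap hn).
by apply/funext => k; rewrite -cats1 wact_cat.
Qed.

Lemma res_succ k : ((k + 1) %% m)%Z = nxt (k %% m)%Z.
Proof.
have [q {1}->] := resP k; have := res_bound k; move: (k %% m)%Z => x hx.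
rewrite /nxt; case: eqP => [->|ne]; last by rewrite -addrA res_eq; ilia.
by rewrite (_ : _ + 1 = (q + 1) * m + 0) ?res_eq; ilia.
Qed.

Lemma swap_res_at i k : (k %% m)%Z = i%:Z -> swap i k = k + 1.
Proof. by rewrite /swap => ->; rewrite /shift eqxx. Qed.

Lemma swap_res_far i k : (k %% m)%Z != i%:Z -> (k %% m)%Z != nxt i%:Z -> swap i k = k.
Proof. by rewrite /swap /shift => /negPf -> /negPf ->; rewrite addr0. Qed.

Lemma res_ord i : (i%:Z %% m)%Z = i%:Z.
Proof. by rewrite modz_small //; have := ltn_ord i; ilia. Qed.

Lemma swap_le i j k : i != j -> (swap i k <= j%:Z) = (k <= j%:Z).
Proof.
rewrite -val_eqE /= => ij; rewrite /swap /shift.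
have [->|nk] := eqVneq k j%:Z; first by rewrite res_ord; ifs.
have [->|nk'] := eqVneq k (j%:Z + 1); last by ifs.
by rewrite res_succ res_ord /nxt; have := ltn_ord i; have := ltn_ord j; ifs.
Qed.

Definition descent f i := f (i%:Z + 1) < f i%:Z.

Lemma descent_res f i k : periodic f -> (k %% m)%Z = i%:Z ->
  descent f i = (f (k + 1) < f k).
Proof.
move=> pf e; have [q ->] := resP k; rewrite e /descent (addrC (q * m)) addrAC.
by rewrite !(periodicM _ _ pf); move: (f _) (f _) (q * m) => X Y Z; ilia.
Qed.

Lemma nxt_inj (x y : int) : 0 <= x <= n%:Z -> 0 <= y <= n%:Z -> nxt x = nxt y -> x = y.
Proof. by rewrite /nxt; ifs. Qed.

Lemma ord_res_bound i : 0 <= i%:Z <= n%:Z.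
Proof. by have := ltn_ord i; ilia. Qed.

(** The type of the vertex with lower set {k <= a}. *)
Definition ord_of a : 'I_n.+1 := inord `|(a %% m)%Z|.

Lemma ord_ofE a : (ord_of a)%:Z = (a %% m)%Z.
Proof. by have := res_bound a; rewrite /ord_of; move: (a %% m)%Z => x hx; rewrite inordK; ilia. Qed.

Lemma sum_ord (l : nat) : \sum_(r < l.+1) r%:Z *+ 2 = l%:Z * l.+1%:Z.
Proof.
elim: l => [|l IH]; first by rewrite big_ord1.
by rewrite big_ord_recr /= IH; ilia.
Qed.

Lemma sum_const_int (c : int) : \sum_(r < n.+1) c = c * m.
Proof. by rewrite sumr_const card_ord -mulr_natr natz. Qed.

Lemma sum_div_id a : \sum_(r < n.+1) ((a - r%:Z) %/ m)%Z = a - n%:Z.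
Proof.
pose h k := (k %% m)%Z.
have ph k : h (k + m) = h k by rewrite /h modzDr.
(* The remainders of n + 1 consecutive integers are 0, ..., n in some order. *)
have e1 : \sum_(r < n.+1) h (a - r%:Z) = \sum_(r < n.+1) r%:Z.
  rewrite (reindex_inj rev_ord_inj) /=.
  rewrite (eq_bigr (fun r : 'I_n.+1 => h (a - n%:Z + r%:Z))); last first.
    by move=> r _; congr h; have := ltn_ord r; ilia.
  rewrite (window_sum _ ph); apply: eq_bigr => r _; rewrite /h modz_small //.
  by have := ltn_ord r; ilia.
have e2 : \sum_(r < n.+1) ((a - r%:Z) %/ m)%Z * m + \sum_(r < n.+1) h (a - r%:Z) =
    a * m - \sum_(r < n.+1) r%:Z.
  rewrite -big_split -sum_const_int -sumrB /=; apply: eq_bigr => r _.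
  by rewrite /h -divz_eq.
have := (sum_ord n); rewrite sumrMnl; move: e2; rewrite e1 -mulr_suml.
move: (\sum_(r < _) r%:Z) (\sum_(r < _) _) => S T h1 h2.
suff : T * m = (a - n%:Z) * m by move/(mulIf (_ : m != 0)); apply.
by rewrite mulrBl; move: h1 h2; rewrite -mulr_natr; ilia.
Qed.

Lemma div_step a b : a <= b <= a + m -> (a %/ m)%Z <= (b %/ m)%Z <= (a %/ m)%Z + 1.
Proof.
case/andP=> ab ba; rewrite lez_pdiv2r //=.
have <- : ((a + m) %/ m)%Z = (a %/ m)%Z + 1.
  by rewrite (_ : a + m = 1 * m + a) ?divzMDl // 1?addrC //; ilia.
exact: lez_pdiv2r.
Qed.

Lemma ord_of_id i : ord_of i%:Z = i.
Proof.
apply: val_inj; apply/eqP; rewrite -eqz_nat ord_ofE modz_small //.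
by have := ltn_ord i; ilia.
Qed.

End AffinePermutations.

(** * The Coxeter group of the cycle acts faithfully on the integers *)

Section CoxeterGroup.
Local Open Scope ring_scope.
Variables (n : nat) (hn : (2 <= n)%N) (W : groupType) (s : 'I_n.+1 -> W).
Hypothesis hcox : coxeter_system (@affineA n) s.
Notation m := (n.+1%:Z).
Implicit Types (i j : 'I_n.+1) (k a : int) (f : int -> int) (w : W).
Local Notation wprod u := (\prod_(i <- u) s i)%g.

Lemma wprod_cat u v : wprod (u ++ v) = (wprod u * wprod v)%g.
Proof. by rewrite big_cat. Qed.

Lemma wprod_rcons u i : wprod (rcons u i) = (wprod u * s i)%g.
Proof. by rewrite -cats1 wprod_cat big_cons big_nil mulg1. Qed.

Lemma relator1 i j : wprod (coxeter_relator (@affineA n) i j) = 1%g.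
Proof.
have := (hcox.2 (coxeter_relator (@affineA n) i j) [::]).2; rewrite big_nil; apply.
by have := CoxRel (@affineA n) [::] [::] i j; rewrite /= !cats0.
Qed.

Lemma sK i : (s i * s i = 1)%g.
Proof.
have := relator1 i i; rewrite /coxeter_relator /affineA eqxx /=.
by rewrite !big_cons big_nil mulg1.
Qed.

Lemma sV i : ((s i)^-1 = s i)%g.
Proof. by rewrite -[LHS]mulg1 -(sK i) mulKg. Qed.

Lemma eq_inv_of_mul1 (x y : W) : (x * y = 1 -> x = y^-1)%g.
Proof. by move=> e; rewrite -[x]mulg1 -(mulgV y) mulgA e mul1g. Qed.

Lemma s_comm i j : i != j -> ~ adjacent i j -> ~ adjacent j i ->
  (s i * s j = s j * s i)%g.
Proof.
move=> ij nij nji; have := relator1 i j.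
rewrite /coxeter_relator /affineA (negPf ij).
case: ifP => [/(affineA_adj ij)[]|_] //=; rewrite !big_cons big_nil mulg1 mulgA.
by move/eq_inv_of_mul1; rewrite invgM !sV.
Qed.

Lemma adjacent_neq i j : adjacent i j -> i != j.
Proof.
by rewrite /adjacent /nxt => h; apply/eqP => e; move: h; rewrite -e; have := ltn_ord i; ifs.
Qed.

Lemma s_braid i j : adjacent i j -> (s i * s j * s i = s j * s i * s j)%g.
Proof.
move=> a; have ij := adjacent_neq a; have := relator1 i j.
have/(affineA_adj ij) := or_introl (adjacent j i) a.
rewrite /coxeter_relator /affineA (negPf ij) => -> /=.
rewrite !big_cons big_nil mulg1 => e.
have /eq_inv_of_mul1 -> : ((s i * s j * s i) * (s j * s i * s j) = 1)%g by rewrite -!mulgA.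
by rewrite !invgM !sV mulgA.
Qed.

Lemma swap_res_next i k : (k %% m)%Z = i%:Z -> swap i (k + 1) = k.
Proof. by move=> e; rewrite -(swap_res_at e) (swapK hn). Qed.

(** Each chain of descents that sorts f down to the identity yields a reduced
    word; sorts f w says that w is the product of such a word. *)
Inductive sorts : (int -> int) -> W -> Prop :=
| sorts_id : sorts id 1%g
| sorts_step f w i : descent f i -> sorts (f \o swap i) w -> sorts f (w * s i)%g.

Lemma sorts_inv f w : sorts f w -> (f = id /\ w = 1%g) \/
  exists i w', [/\ descent f i, sorts (f \o swap i) w' & w = (w' * s i)%g].
Proof. by case=> [|f' w' i d h]; [left|right; exists i, w']. Qed.

Lemma comp_swapK f i : (f \o swap i) \o swap i = f.
Proof. by apply/funext => k /=; rewrite swapK. Qed.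

Lemma descent_id i : descent id i = false.
Proof. by rewrite /descent; ilia. Qed.

Lemma displacement_ge0 f : 0 <= displacement n f.
Proof. by apply: sumr_ge0 => r _; apply: sqr_ge0. Qed.

Lemma displacement_descent f i N : affine_perm n f -> descent f i -> displacement n f < N.+1%:Z ->
  displacement n (f \o swap i) < N%:Z.
Proof.
case=> pf _ _; rewrite /descent (displacement_swap hn _ pf).
by move: (displacement _ _) (f _) (f _) => X Y Z; ilia.
Qed.

Lemma descent_swap f i : affine_perm n f -> descent (f \o swap i) i = ~~ descent f i.
Proof.
case=> _ jf _; rewrite /descent /= swap_at (swap_next hn).
have : f (i%:Z + 1) <> f i%:Z by move/jf; ilia.
by move: (f _) (f _) => X Y; ilia.
Qed.

(** Without descents f increases by at least 1 at each step, and it increases by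
    exactly m over a period; so f is a translation. *)
Lemma sorted_id f : affine_perm n f -> (forall i, ~~ descent f i) -> f = id.
Proof.
case=> pf jf sf nd.
have inc (r : nat) : (r < n.+1)%N -> f r%:Z + 1 <= f (r%:Z + 1).
  move=> hr; have := nd (Ordinal hr); rewrite /descent /=.
  have : f (r%:Z + 1) <> f r%:Z by move/jf; ilia.
  by move: (f _) (f _) => X Y; ilia.
have lo (r : nat) : (r <= n.+1)%N -> f 0 + r%:Z <= f r%:Z.
  elim: r => [|r IH] hr; first by rewrite addr0.
  have := IH (ltnW hr); have := inc r hr; rewrite (_ : r%:Z + 1 = r.+1%:Z); last by ilia.
  by move: (f _) (f _) (f _) => X Y Z; ilia.
have hi (r : nat) : (r <= n.+1)%N -> f (n.+1 - r)%N%:Z <= f m - r%:Z.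
  elim: r => [|r IH] hr; first by rewrite subn0 subr0.
  have := IH (ltnW hr); have := inc (n.+1 - r.+1)%N.
  rewrite (_ : (n.+1 - r.+1)%N%:Z + 1 = (n.+1 - r)%N%:Z); last by ilia.
  move=> /(_ _); move: (f _) (f _) (f _) => X Y Z; have : (n.+1 - r.+1 < n.+1)%N by ilia.
  by move=> -> /(_ isT); ilia.
have fm : f m = f 0 + m by rewrite -[m]add0r pf.
have fr (r : nat) : (r <= n)%N -> f r%:Z = f 0 + r%:Z.
  move=> hr; have := lo r; have := hi (n.+1 - r)%N; rewrite subKn ?fm; last by ilia.
  move: (f _) (f _) => X Y; rewrite leq_subr leqW // => /(_ isT) h1 /(_ isT) h2; ilia.
have f0 : f 0 = 0.
  move: sf; rewrite (eq_bigr (fun=> f 0)); last first.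
    by move=> r _; rewrite fr ?addrK // -ltnS.
  by rewrite sumr_const card_ord => /eqP; rewrite mulrn_eq0 /= => /eqP.
apply/funext => k; have [q ->] := resP n k; have := res_bound n k.
case: (k %% m)%Z => // r hr; rewrite addrC (periodicM _ _ pf) fr ?f0 ?add0r //; ilia.
Qed.

Lemma sorts_ex f : affine_perm n f -> exists w, sorts f w.
Proof.
have [N] : exists N : nat, displacement n f < N%:Z.
  by exists (`|displacement n f|.+1)%N; have := displacement_ge0 f; ilia.
elim: N f => [|N IH] f hN gf; first by have := displacement_ge0 f; ilia.
have [[i di]|nd] := pselect (exists i, descent f i).
  have [w hw] := IH _ (displacement_descent gf di hN) (affine_perm_swap hn i gf).
  by exists (w * s i)%g; apply: sorts_step.
exists 1%g; rewrite (sorted_id gf); first exact: sorts_id.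
by move=> i; apply/negP => di; apply: nd; exists i.
Qed.

Definition unique_sort f := forall w w', sorts f w -> sorts f w' -> w = w'.

(** Disjoint swaps can be done in either order, so both words can be completed
    to words that differ by one commutation. *)
Lemma sort_far f i j w1 w2 : affine_perm n f -> i != j -> ~ adjacent i j -> ~ adjacent j i ->
  descent f i -> descent f j -> unique_sort (f \o swap i) -> unique_sort (f \o swap j) ->
  sorts (f \o swap i) w1 -> sorts (f \o swap j) w2 -> (w1 * s i = w2 * s j)%g.
Proof.
move=> gf ij nij nji di dj ui uj s1 s2.
have far (a b : 'I_n.+1) : a != b -> ~ adjacent a b -> ~ adjacent b a ->
    descent f b -> descent (f \o swap a) b.
  move=> ab nab nba; rewrite /descent /= => d.
  have ab' : a%:Z <> b%:Z by move: ab; rewrite -val_eqE /=; ilia.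
  rewrite (@swap_res_far n a (b%:Z + 1)) ?res_succ ?res_ord.
  - rewrite (@swap_res_far n a b%:Z) ?res_ord //; apply/eqP => h; first by apply: ab'; rewrite h.
    by apply: nab; rewrite /adjacent h.
  - by apply/eqP.
  - by apply/eqP => /(nxt_inj (ord_res_bound b) (ord_res_bound a)) h; apply: ab'; rewrite h.
have fij : f \o swap i \o swap j = f \o swap j \o swap i.
  by apply/funext => k /=; rewrite swap_comm.
have [w0 h0] := sorts_ex (affine_perm_swap hn j (affine_perm_swap hn i gf)).
rewrite (ui _ _ s1 (sorts_step (far _ _ ij nij nji dj) h0)).
rewrite fij in h0; rewrite eq_sym in ij.
rewrite (uj _ _ s2 (sorts_step (far _ _ ij nji nij di) h0)).
by rewrite -!mulgA (s_comm ij).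
Qed.

(** Two adjacent descents mean that three consecutive values decrease; these
    can be sorted completely in two ways, which differ by the braid relation. *)
Lemma sort_adjacent f i j w1 w2 : affine_perm n f -> adjacent i j ->
  descent f i -> descent f j -> unique_sort (f \o swap i) -> unique_sort (f \o swap j) ->
  sorts (f \o swap i) w1 -> sorts (f \o swap j) w2 -> (w1 * s i = w2 * s j)%g.
Proof.
move=> gf ij di dj ui uj s1 s2.
have [pf _ _] := gf.
pose x := i%:Z; have xi : (x %% m)%Z = i%:Z := res_ord i.
have xj : ((x + 1) %% m)%Z = j%:Z by rewrite res_succ xi.
have xk : ((x + 1 + 1) %% m)%Z = nxt n j%:Z by rewrite res_succ xj.
have b1 : swap i x = x + 1 := swap_res_at xi.
have b2 : swap i (x + 1) = x := swap_res_next xi.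
have hj : nxt n i%:Z = j%:Z := ij.
have b3 : swap i (x + 1 + 1) = x + 1 + 1.
  apply: swap_res_far; rewrite xk -hj; have := ltn_ord i; rewrite /nxt; ifs.
have b4 : swap j (x + 1) = x + 1 + 1 := swap_res_at xj.
have b5 : swap j (x + 1 + 1) = x + 1 := swap_res_next xj.
have b6 : swap j x = x.
  apply: swap_res_far; rewrite xi -hj; have := ltn_ord i; rewrite /nxt; ifs.
have ABi : f (x + 1) < f x by rewrite -(descent_res pf xi).
have BC : f (x + 1 + 1) < f (x + 1) by rewrite -(descent_res pf xj).
have [gi gj] := (affine_perm_swap hn i gf, affine_perm_swap hn j gf).
have [gij gji] := (affine_perm_swap hn j gi, affine_perm_swap hn i gj).
(* f has values A > B > C on x, x + 1, x + 2. Each of the two sequences of swaps passes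
   through two more permutations and ends with C < B < A. *)
have dij : descent (f \o swap i) j.
  by case: gi => p _ _; rewrite (descent_res p xj) /= b2 b3 (lt_trans BC).
have diji : descent (f \o swap i \o swap j) i.
  by case: gij => p _ _; rewrite (descent_res p xi) /= b6 b1 b4 b3.
have dji : descent (f \o swap j) i.
  by case: gj => p _ _; rewrite (descent_res p xi) /= b6 b4 (lt_trans BC).
have djij : descent (f \o swap j \o swap i) j.
  by case: gji => p _ _; rewrite (descent_res p xj) /= b2 b3 b5 b6.
have [w0 h0] := sorts_ex (affine_perm_swap hn i gij).
rewrite (ui _ _ s1 (sorts_step dij (sorts_step diji h0))).
have fij : f \o swap i \o swap j \o swap i = f \o swap j \o swap i \o swap j.
  by apply/funext => k /=; rewrite swap_braid.
rewrite fij in h0.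
rewrite (uj _ _ s2 (sorts_step dji (sorts_step djij h0))).
by have := s_braid ij; rewrite -!mulgA => ->.
Qed.

(** Induction on the displacement: the first swaps i and j of two chains of
    descents can be continued to a common permutation. *)
Lemma sorts_unique f : affine_perm n f -> unique_sort f.
Proof.
have [N] : exists N : nat, displacement n f < N%:Z.
  by exists (`|displacement n f|.+1)%N; have := displacement_ge0 f; ilia.
elim: N f => [|N IH] f hN gf; first by have := displacement_ge0 f; ilia.
move=> w w' /sorts_inv [[fe ->]|[i [w1 [di s1 ->]]]] /sorts_inv [[fe' ->]|[j [w2 [dj s2 ->]]]] //.
- by move: dj; rewrite fe descent_id.
- by move: di; rewrite fe' descent_id.
have ui := IH _ (displacement_descent gf di hN) (affine_perm_swap hn i gf).
have uj := IH _ (displacement_descent gf dj hN) (affine_perm_swap hn j gf).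
have [e|ij] := eqVneq i j; first by subst j; rewrite (ui _ _ s1 s2).
have [a|na] := pselect (adjacent i j); first exact: sort_adjacent gf a di dj ui uj s1 s2.
have [a|nb] := pselect (adjacent j i); first exact/esym/(sort_adjacent gf a dj di uj ui s2 s1).
exact: sort_far gf ij na nb di dj ui uj s1 s2.
Qed.

Lemma sorts_swap f w i : affine_perm n f -> sorts f w -> sorts (f \o swap i) (w * s i)%g.
Proof.
move=> gf sw; have gi := affine_perm_swap hn i gf.
have [di|ndi] := boolP (descent f i); last first.
  by apply: sorts_step; rewrite ?comp_swapK ?descent_swap.
have [w' h] := sorts_ex gi.
by rewrite (sorts_unique gf sw (sorts_step di h)) -mulgA sK mulg1.
Qed.

(** This is where faithfulness comes from: the element of W is determined by the
    permutation. *)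
Lemma sorts_wact u : sorts (wact u) (wprod u).
Proof.
elim/last_ind: u => [|u i IH]; first by rewrite big_nil; exact: sorts_id.
have -> : wact (rcons u i) = wact u \o swap i.
  by apply/funext => k; rewrite -cats1 wact_cat.
rewrite wprod_rcons.
by apply: sorts_swap => //; exact: (wact_affine_perm hn).
Qed.

Definition zact w : int -> int := wact (projT1 (cid (hcox.1 w))).

Lemma zact_prod u : zact (wprod u) = wact u.
Proof.
rewrite /zact; case: cid => v /= e; apply/funext => k.
by apply: (wact_equiv hn); apply/(hcox.2 v u).1.
Qed.

Lemma wprod_surj w : exists u, w = wprod u.
Proof. by have [u <-] := hcox.1 w; exists u. Qed.

Lemma zact1 k : zact 1%g k = k.
Proof. by have := zact_prod [::]; rewrite big_nil => ->. Qed.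

Lemma zact_s i : zact (s i) = swap i.
Proof. by have := zact_prod [:: i]; rewrite big_cons big_nil mulg1. Qed.

Lemma zactM w w' k : zact (w * w')%g k = zact w (zact w' k).
Proof.
have [u ->] := wprod_surj w; have [v ->] := wprod_surj w'.
by rewrite -wprod_cat !zact_prod wact_cat.
Qed.

Lemma zactK w k : zact w^-1%g (zact w k) = k.
Proof. by rewrite -zactM mulVg zact1. Qed.

Lemma zactVK w k : zact w (zact w^-1%g k) = k.
Proof. by rewrite -zactM mulgV zact1. Qed.

Lemma zact_affine_perm w : affine_perm n (zact w).
Proof. by have [u ->] := wprod_surj w; rewrite zact_prod; exact: (wact_affine_perm hn). Qed.

Lemma sorts_zact w : sorts (zact w) w.
Proof. by have [u ->] := wprod_surj w; rewrite zact_prod; exact: sorts_wact. Qed.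

Lemma zact_surj f : affine_perm n f -> exists w, zact w = f.
Proof.
move=> gf; have [w h] := sorts_ex gf; exists w; elim: h => {w gf f} [|f w i d _ IH].
  by apply/funext => k; exact: zact1.
apply/funext => k; rewrite zactM IH zact_s; exact: congr1 (swapK hn i k).
Qed.

Definition stab (j : 'I_n.+1) w := forall k, (zact w k <= j%:Z) = (k <= j%:Z).

(** A permutation that preserves {k <= j} has no descent at j, and sorting it by
    its descents keeps this property. *)
Lemma stab_parabolic j w : stab j w <-> parabolic s (predC1 j) w.
Proof.
split=> [|[u hu <-]].
  rewrite /stab; have := sorts_zact w; have := zact_affine_perm w.
  move: (zact w) => f; move=> + h; elim: h => {w f} [|f w i d _ IH] gf sf.
    by exists [::]; rewrite // big_nil.
  have ij : i != j.
    apply/eqP => e; subst i; have := sf j%:Z; have := sf (j%:Z + 1); move: d; rewrite /descent.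
    by move: (f _) (f _) => X Y; ilia.
  have [|u hu <-] := IH (affine_perm_swap hn i gf).
    by move=> k /=; rewrite sf swap_le.
  exists (rcons u i); first by rewrite /= all_rcons /= ij.
  by rewrite wprod_rcons.
elim: u hu => [|i u IH] /=; first by rewrite big_nil => _ k; rewrite zact1.
move=> /andP [ij hu] k; rewrite big_cons zactM zact_s swap_le //; exact: IH.
Qed.

(** The coset w W_(S - s_j) is recorded by the lower set w {k <= j}. *)
Lemma vertexE w j y : coxeter_vertex s w j y <->
  forall k, (zact y^-1%g k <= j%:Z) = (zact w^-1%g k <= j%:Z).
Proof.
split=> [[x /stab_parabolic hx <-] k|h].
  by rewrite invgM zactM -[in LHS](hx (zact _ _)) zactVK.
exists (w^-1 * y)%g; last by rewrite mulVKg.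
apply/stab_parabolic => k; rewrite zactM -h -zactM.
by rewrite mulVg zact1.
Qed.

Lemma vertex_eq w w' j : coxeter_vertex s w j = coxeter_vertex s w' j <->
  forall k, (zact w^-1%g k <= j%:Z) = (zact w'^-1%g k <= j%:Z).
Proof.
split=> [e|h].
  by apply/vertexE; rewrite -e; apply/vertexE.
by apply/seteqP; split=> y /vertexE hy; apply/vertexE => k; rewrite hy h.
Qed.

(** Thinness: an element of all W_(S - s_j) with j other than i can only have
    descents at i. *)
Lemma vertex_panel w w' i :
  (forall j, j != i -> coxeter_vertex s w j = coxeter_vertex s w' j) ->
  w' = w \/ w' = (w * s i)%g.
Proof.
move=> h; pose x := (w^-1 * w')%g.
have hx j : j != i -> stab j x.
  move=> ji k; rewrite /x zactM; have /vertex_eq := h j ji => /(_ (zact w' k)) ->.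
  by rewrite zactK.
have nd f j : (forall k, (f k <= j%:Z) = (k <= j%:Z)) -> ~ descent f j.
  move=> sf; have := sf j%:Z; have := sf (j%:Z + 1); rewrite /descent.
  by move: (f _) (f _) => X Y; ilia.
suff [x1|xs] : x = 1%g \/ x = s i.
- by left; rewrite -(mulVKg w w') -/x x1 mulg1.
- by right; rewrite -xs mulVKg.
have := sorts_zact x; case/sorts_inv => [[_ ->]|[j [y [dj hy ->]]]]; first by left.
have ej : j = i.
  by apply/eqP; apply: contraT => ji; case: (nd _ _ (hx j ji) dj).
subst j; right.
case/sorts_inv: hy => [[_ ->]|[j [z [dj' _ _]]]]; first by rewrite mul1g.
have [e|ji] := eqVneq j i.
  by move: dj'; rewrite e (descent_swap _ (zact_affine_perm x)) dj.
by case: (nd _ _ _ dj') => k; rewrite /= hx // swap_le // eq_sym.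
Qed.

End CoxeterGroup.

(** * Normal paths in the charts of a building *)

Section Charts.
Local Open Scope ring_scope.
Variables (n : nat) (V : Type) (D : set (set V)) (tau : V -> 'I_n.+1).
Notation vec := {ffun 'I_n.+1 -> int}.
Implicit Types (p q d : vec) (x y z : V) (k : vec -> V).

(** Unlike ffunE, these rules leave the entries in a form that lia recognizes. *)
Lemma vecD p q r : (p + q) r = p r + q r. Proof. by rewrite ffunE. Qed.
Lemma vecN p r : (- p) r = - p r. Proof. by rewrite ffunE. Qed.
Lemma vec0 r : (0 : vec) r = 0. Proof. by rewrite ffunE. Qed.

(** Truncation at height t: the path from p to p + d is p + cap t d. *)
Definition cap (t : nat) d : vec := [ffun r => Num.min (d r) t%:Z].
Lemma capE t d r : cap t d r = Num.min (d r) t%:Z. Proof. by rewrite ffunE. Qed.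
Lemma vecP p q : (forall r, p r = q r :> int) -> p = q. Proof. by move=> h; apply/ffunP. Qed.
Definition vecE := (vecD, vecN, vec0, capE).

(** The difference q - p has spread at most l. In an apartment this is distance
    at most l, and near 0 is equality up to a constant vector. *)
Definition near (l : nat) p q := forall r s : 'I_n.+1, (q r - p r) - (q s - p s) <= l%:Z.

Lemma near_sym l p q : near l p q -> near l q p.
Proof. by move=> h r s; have := h s r; ilia. Qed.

Lemma near_trans l1 l2 l p q u : (l1 + l2 <= l)%N ->
  near l1 p q -> near l2 q u -> near l p u.
Proof. by move=> hl h1 h2 r s; have := h1 r s; have := h2 r s; ilia. Qed.

Lemma near_add0 l p q : near l p (p + q) <-> near l 0 q.
Proof. by split=> h r s; have := h r s; rewrite !vecE; ilia. Qed.

Definition typediff x y (p q : vec) :=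
  ((n.+1%:Z) %| ((tau y)%:Z - (tau x)%:Z) - (\sum_r q r - \sum_r p r))%Z.

(** The coordinates of an apartment, together with the retractions onto it. The
    last condition says that only the vertex at p is sent to p; it holds for the
    retraction centred at a chamber that contains this vertex. All conditions are
    invariant under type-rotating automorphisms, while the given system of
    apartments may fail to be. *)
Record is_chart k : Prop := {
  chart_eq : forall p q, k p = k q <-> near 0 p q;
  chart_adj : forall p q, near 1 p q -> D [set k p; k q]%classic;
  chart_retract : forall p, exists rho : V -> vec,
    [/\ forall q, near 0 (rho (k q)) q,
        forall x y, D [set x; y]%classic -> near 1 (rho x) (rho y),
        forall x y, typediff x y (rho x) (rho y) &
        forall x, near 0 (rho x) p -> x = k p] }.

Lemma chart_near k p q : is_chart k -> D [set k p; k q]%classic -> near 1 p q.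
Proof.
move=> ck; have [rho [h1 h2 _ _]] := chart_retract ck p; move=> /h2 h.
apply: (near_trans (l1 := 0) (l2 := 1)) (near_sym (h1 p)) _ => //.
exact: (near_trans (l1 := 1) (l2 := 0)) h (h1 q).
Qed.

(** The representative of a difference modulo constants with minimum 0; its
    maximum h is the distance. *)
Definition normal (h : nat) d :=
  [/\ forall r, 0 <= d r <= h%:Z, exists r, d r = 0 & exists r, d r = h%:Z].

Lemma normalize p q : exists h d, normal h d /\ near 0 (p + d) q.
Proof.
pose f r := q r - p r.
have [lo hlo] : exists lo, forall r, f lo <= f r.
  case: (@Order.TotalTheory.arg_minP _ _ 'I_n.+1 ord0 xpredT f isT) => i _ hi.
  by exists i => r; exact: hi.
have [hi hhi] : exists hi, forall r, f r <= f hi.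
  case: (@Order.TotalTheory.arg_maxP _ _ 'I_n.+1 ord0 xpredT f isT) => i _ hi.
  by exists i => r; exact: hi.
exists (absz (f hi - f lo)), [ffun r => f r - f lo]; split.
  split; [|exists lo|exists hi]; rewrite ?(vecE, ffunE); last 2 first.
  - by ilia.
  - by have := hlo hi; ilia.
  by move=> r; rewrite !(vecE, ffunE); have := hlo r; have := hhi r; ilia.
by move=> r s; rewrite !(vecE, ffunE) /f; ilia.
Qed.

Lemma normal_near h d l : normal h d -> near l 0 d -> (h <= l)%N.
Proof.
by case=> _ [r dr] [s ds] /(_ s r); rewrite !(vecE, ffunE) dr ds; ilia.
Qed.

Lemma near_normal h d l : normal h d -> (h <= l)%N -> near l 0 d.
Proof.
by case=> hd _ _ hl r s; rewrite !(vecE, ffunE); have := hd r; have := hd s; ilia.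
Qed.

Lemma normal_cap h d t : normal h d -> (t <= h)%N -> normal t (cap t d).
Proof.
case=> hd [a da] [b db] ht; split; [|exists a|exists b]; rewrite ?(vecE, ffunE); try ilia.
by move=> r; rewrite !(vecE, ffunE); have := hd r; ilia.
Qed.

Lemma cap_full h d : normal h d -> cap h d = d.
Proof. by case=> hd _ _; apply: vecP=> r; rewrite !(vecE, ffunE); have := hd r; ilia. Qed.

Lemma cap_ge h t d : normal h d -> (h <= t)%N -> cap t d = d.
Proof. by case=> hd _ _ ht; apply: vecP=> r; rewrite !(vecE, ffunE); have := hd r; ilia. Qed.

Lemma cap0 h d : normal h d -> cap 0 d = 0.
Proof. by case=> hd _ _; apply: vecP=> r; rewrite !(vecE, ffunE); have := hd r; ilia. Qed.

Lemma cap_cap s t d : (s <= t)%N -> cap s (cap t d) = cap s d.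
Proof. by move=> st; apply: vecP=> r; rewrite !(vecE, ffunE); ilia. Qed.

(** Retractions do not lengthen paths. *)
Lemma retract_path (rho : V -> vec) (x : nat -> V) l :
  (forall x y, D [set x; y]%classic -> near 1 (rho x) (rho y)) ->
  (forall i, (i < l)%N -> D [set x i; x i.+1]%classic) ->
  near l (rho (x 0%N)) (rho (x l)).
Proof.
move=> hrho; elim: l => [|l IH] hx; first by move=> r s; ilia.
apply: (near_trans (l1 := l) (l2 := 1)); first by rewrite addn1.
  by apply: IH => i il; apply: hx; ilia.
exact: hrho (hx l _).
Qed.

Lemma chart_path_adj k p d i : is_chart k ->
  D [set k (p + cap i d); k (p + cap i.+1 d)]%classic.
Proof.
by move=> hk; apply: chart_adj => // r s; rewrite !(vecE, ffunE); ilia.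
Qed.

(** Retract the path of length h' onto the apartment of k. *)
Lemma chart_width k k' h h' p p' d d' : is_chart k -> is_chart k' ->
  normal h d -> normal h' d' -> k p = k' p' -> k (p + d) = k' (p' + d') ->
  (h <= h')%N.
Proof.
move=> ck ck' hd hd' e0 e1.
have [rho [rk r1 _ _]] := chart_retract ck p.
have := retract_path r1 (fun i (_ : (i < h')%N) => chart_path_adj p' d' i ck').
rewrite (cap0 hd') (cap_full hd') addr0 -e0 -e1 => H.
apply: (normal_near hd); rewrite -near_add0.
apply: (near_trans (l1 := h') (l2 := 0)); first by rewrite addn0.
  by apply: near_trans (near_sym (rk p)) H.
exact: rk.
Qed.

(** The image of y under the retraction is p + d minus the indicator of some set
    R. As it is at distance at most h from p, the set R contains S, where d is
    maximal; comparing types gives R the cardinality of S', which is at most that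
    of S. So the image is the vertex at which the retraction is injective. *)
Lemma chart_pred_le k k' h p p' d d' : is_chart k -> is_chart k' ->
  normal h.+1 d -> normal h.+1 d' -> k p = k' p' -> k (p + d) = k' (p' + d') ->
  (#|[set r | d' r == h.+1%:Z]| <= #|[set r | d r == h.+1%:Z]|)%N ->
  k' (p' + cap h d') = k (p + cap h d).
Proof.
move=> ck ck' nd nd' e0 e1; set S' := [set r | _]; set S := [set r | _] => SS.
have [rho [rk r1 rt rfib]] := chart_retract ck (p + cap h d).
have [rho' [rk' _ rt' _]] := chart_retract ck' p'.
set y := k' _; apply: rfib.
(* The image of y is at distance at most h from the origin, as y is. *)
have hx : near h p (rho y).
  have := retract_path r1 (fun i (_ : (i < h)%N) => chart_path_adj p' d' i ck').
  rewrite (cap0 nd') addr0 -e0 => H.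
  by apply: near_trans (near_sym (rk p)) H.
have hy : near 1 (rho y) (p + d).
  apply: near_trans (_ : near 1 (rho y) (rho (k (p + d)))) (rk _) => //.
  apply: r1; rewrite e1 /y -{2}(cap_full nd'); exact: chart_path_adj.
have [hd [s ds] [t dt]] := nd.
have [hd' [s' ds'] [t' dt']] := nd'.
(* The step from the image of y to p + d; d vanishes at s, where w is minimal. *)
pose w : vec := p + d - rho y.
pose R := [set r | w r == w s + 1].
have wE r : w r = p r + d r - rho y r by rewrite !(vecE, ffunE).
have wS r : r \in S -> r \in R.
  rewrite !inE => /eqP dr; apply/eqP; rewrite !wE.
  by have := hx s r; have := hx r s; have := hy r s; rewrite !(vecE, ffunE) dr ds; ilia.
have [a aS] : exists a, a \in S by exists t; rewrite inE dt.
have wR r : w r = w s + (r \in R)%:Z.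
  rewrite inE; case: eqP => // ne; rewrite addr0.
  have := wS _ aS; move: aS; rewrite !inE => /eqP da /eqP; move: ne; rewrite !wE.
  by have := hy r a; have := hy r s; have := hy a r; rewrite !(vecE, ffunE) da ds; ilia.
have sumR (T : {set 'I_n.+1}) : \sum_r ((r \in T)%:Z : int) = #|T|%:Z.
  by rewrite -sum1_card -natz natr_sum [RHS]big_mkcond /=; apply: eq_bigr => r _; case: (r \in T).
have sumc := @sum_const_int n.
have sumw : \sum_r w r = w s * n.+1%:Z + #|R|%:Z.
  rewrite (eq_bigr (fun r => w s + (r \in R)%:Z)); last by move=> r _; exact: wR.
  by rewrite big_split /= sumc sumR.
have near_sum (u v : vec) : near 0 u v -> exists c : int, \sum_r v r = \sum_r u r + c * n.+1%:Z.
  move=> uv; exists (v s - u s).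
  rewrite -sumc -big_split /=.
  by apply: eq_bigr => r _; have := uv r s; have := uv s r; ilia.
(* Both sizes are the difference of the types of y and of the end, modulo n + 1. *)
have RS' : (n.+1%:Z %| #|R|%:Z - #|S'|%:Z)%Z.
  have := rt y (k (p + d)); have := rt' y (k (p + d)); rewrite /typediff e1 /y.
  have [c1 ->] := near_sum _ _ (near_sym (rk' (p' + d'))).
  have [c2 ->] := near_sum _ _ (near_sym (rk' (p' + cap h d'))).
  rewrite -/y -e1.
  have [c3 ->] := near_sum _ _ (near_sym (rk (p + d))).
  have -> : \sum_r (p + d) r = \sum_r w r + \sum_r (rho y) r.
    by rewrite -big_split /=; apply: eq_bigr => r _; rewrite wE !(vecE, ffunE); ilia.
  have -> : \sum_r (p' + d') r = \sum_r (p' + cap h d') r + #|S'|%:Z.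
    rewrite -(sumR S') -big_split /=; apply: eq_bigr => r _; rewrite !(vecE, ffunE) inE.
    by have := hd' r; case: eqP; ilia.
  rewrite sumw => /dvdzP [u hu] /dvdzP [v hv]; apply/dvdzP.
  exists (u - v - w s + c1 - c2 - c3).
  rewrite !mulrDl !mulNr; move: (u : int) (v : int) hu hv => {}u {}v.
  move: (\sum_r rho y r) (\sum_r (p' + _) r) (w s) (n.+1%:Z) => X Y Z N; ilia.
have sR : s \notin R by rewrite inE; apply/eqP; ilia.
have s'S : s' \notin S' by rewrite inE ds'.
have ltT (T : {set 'I_n.+1}) u : u \notin T -> (#|T| < n.+1)%N.
  move=> uT; rewrite -[X in (_ < X)%N]card_ord -cardsT proper_card //.
  by apply/properP; split; [exact: finset.subsetT | exists u; rewrite ?inE].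
(* Neither set contains all coordinates, so the congruence is an equality. *)
have cRS : #|R| = #|S'|.
  have := ltT _ _ sR; have := ltT _ _ s'S.
  have /dvdzP [c] := RS'; move: (c : int) => {}c.
  have [->|[c1|c1]] : c = 0 \/ c <= -1 \/ 1 <= c by ilia.
  - by rewrite mul0r; ilia.
  - by move: #|R| #|S'| => a1 b1; nia.
  - by move: #|R| #|S'| => a1 b1; nia.
have eRS : S = R.
  by apply/eqP; rewrite eqEcard cRS SS andbT; apply/fintype.subsetP => r /wS.
move=> r u; rewrite !(vecE, ffunE).
have rw v : rho y v = p v + d v - w s - (v \in S)%:Z by rewrite eRS; have := wR v; rewrite wE; ilia.
by rewrite !rw !inE; have := hd r; have := hd u; ilia.
Qed.

Lemma chart_pred k k' h h' p p' d d' : is_chart k -> is_chart k' ->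
  normal h.+1 d -> normal h' d' -> k p = k' p' -> k (p + d) = k' (p' + d') ->
  h' = h.+1 /\ k (p + cap h d) = k' (p' + cap h d').
Proof.
move=> ck ck' nd nd' e0 e1.
have hh : h' = h.+1.
  apply/eqP; rewrite eqn_leq (chart_width ck' ck nd' nd (esym e0) (esym e1)).
  by rewrite (chart_width ck ck' nd nd' e0 e1).
subst h'; split=> //.
have [le|/ltnW le] := leqP #|[set r | d' r == h.+1%:Z]| #|[set r | d r == h.+1%:Z]|.
  by rewrite (chart_pred_le ck ck' nd nd' e0 e1 le).
by rewrite (chart_pred_le ck' ck nd' nd (esym e0) (esym e1) le).
Qed.

(** y is the last vertex before z on the normal path, of length h + 1, from x to
    z, as seen in some chart. *)
Definition last_step h x y z := exists k p d,
  [/\ is_chart k, normal h.+1 d, k p = x, k (p + cap h d) = y & k (p + d) = z].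

Lemma last_step_chart h h' x y z k p d : last_step h x y z -> is_chart k -> normal h' d ->
  k p = x -> k (p + d) = z -> h' = h.+1 /\ y = k (p + cap h d).
Proof.
move=> [k' [p' [d' [ck' nd' <- <- <-]]]] ck nd e0 e1.
by apply: chart_pred.
Qed.

Hypothesis ex_chart : forall x y z, D [set y; z]%classic ->
  exists k p q u, [/\ is_chart k, k p = x, k q = y & k u = z].

(** In a chart that contains x, z and u, uniqueness puts y in its place, and
    applied once more to y, z, u it shows that the set of the step to u is
    contained in that of the step to z. *)
Lemma last_stepS h x y z u : D [set z; u]%classic ->
  last_step h x y z -> last_step 1 y z u -> last_step h.+1 x z u.
Proof.
move=> Dzu cxyz cyzu.
have [k [p [q [q' [ck kp kq kq']]]]] := ex_chart x Dzu.
have [h' [d [nd npd]]] := normalize p q.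
have kpd : k (p + d) = z by rewrite -kq; apply/chart_eq.
have [eh ey] := last_step_chart cxyz ck nd kp kpd; subst h'.
have nqq' : near 1 q q' by apply: (chart_near ck); rewrite kq kq'.
have [m1 [e [ne nqe]]] := normalize (p + d) q'.
have ke : k (p + d + e) = u by rewrite -kq'; apply/chart_eq.
have m1le : (m1 <= 1)%N.
  apply: (normal_near ne); rewrite -(near_add0 _ (p + d)).
  apply: near_trans (_ : near 1 (p + d) q') (near_sym nqe) => //.
  by apply: near_trans npd nqq'.
have [hd [a da] [b db]] := nd; have [he [a' ea] [b' eb]] := ne.
(* The two steps from y to z and from z to u, added up. *)
pose f : vec := d - cap h d + e.
have kf : k (p + cap h d + f) = u.
  by rewrite -ke; congr (k _); rewrite /f; apply: vecP=> r; rewrite !(vecE, ffunE); ilia.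
have fE r : f r = d r - Num.min (d r) h%:Z + e r by rewrite /f !(vecE, ffunE).
clearbody f.
have [h2 [g [ng nfg]]] := normalize (p + cap h d) (p + cap h d + f).
have kg : k (p + cap h d + g) = u by rewrite -kf; apply/chart_eq.
have [eh2 ez] := last_step_chart cyzu ck ng (esym ey) kg; subst h2.
(* The spread of f is that of g, namely 2, and f takes its values in 0, 1, 2. *)
have gf : g = f.
  have [hg [c gc] [c' gc']] := ng.
  have := nfg c c'; have := nfg c' c; rewrite !(vecE, ffunE) !fE gc gc' => n1 n2.
  apply: vecP=> r; have := nfg r c; have := nfg c r; rewrite !(vecE, ffunE) !fE gc.
  by have := hd r; have := hd c; have := hd c'; have := he c; have := he c'; ilia.
subst g.
have := ez; rewrite -kpd => /(chart_eq ck) N.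
(* The two positions of z agree, so the second step is along a subset of the first. *)
have Td r : e r = 1 -> d r = h.+1%:Z.
  move=> er; have := N r a; have := N b a; have := N a r; rewrite !(vecE, ffunE) !fE da db er.
  have := hd r; have := he a; have := he b.
  have [_ [c fc] [c' fc']] := ng; move: fc fc'; rewrite !fE.
  have := N c r; have := N r c; rewrite !(vecE, ffunE) !fE er.
  have := hd c; have := he c; ilia.
have e01 r : e r = 0 \/ e r = 1 by have := he r; ilia.
have [c ec] : exists c, e c = 1.
  have [_ _ [c' fc']] := ng; exists c'; move: fc'; rewrite fE.
  by have := hd c'; have := e01 c'; ilia.
exists k, p, (d + e); split=> //.
- split.
  + move=> r; rewrite !(vecE, ffunE); have := hd r; have := e01 r; have := Td r; ilia.
  + exists a; rewrite !(vecE, ffunE); have := Td a; have := e01 a; ilia.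
  + by exists c; rewrite !(vecE, ffunE) ec (Td c ec); ilia.
- congr (k (p + _)); apply: vecP=> r; rewrite !(vecE, ffunE).
  by have := hd r; have := e01 r; have := Td r; ilia.
- by rewrite addrA.
Qed.

(** A path that is normal locally, that is, on each subpath of length two. *)
Definition straight (l : nat) (x : nat -> V) :=
  (forall i, (i < l)%N -> D [set x i; x i.+1]%classic /\ x i <> x i.+1) /\
  (forall i, (i.+1 < l)%N -> last_step 1 (x i) (x i.+1) (x i.+2)).

Lemma last_step0 x y : D [set x; y]%classic -> x <> y -> last_step 0 x x y.
Proof.
move=> Dxy xy.
have [k [p [_ [q [ck kp _ kq]]]]] := ex_chart x Dxy.
have [h [d [nd npd]]] := normalize p q.
have kpd : k (p + d) = y by rewrite -kq; apply/chart_eq.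
have h1 : (h <= 1)%N.
  apply: (normal_near nd); rewrite -(near_add0 _ p).
  by apply: (chart_near ck); rewrite kp kpd.
have h0 : h <> 0.
  move=> h0; apply: xy; rewrite -kp -kpd; apply/chart_eq => //; apply/near_add0.
  by apply: near_normal nd _; rewrite h0.
have eh : h = 1 by ilia.
subst h; exists k, p, d; split=> //.
by rewrite (cap0 nd) addr0.
Qed.

Lemma straight_last_step l (x : nat -> V) i : straight l x -> (i < l)%N ->
  last_step i (x 0%N) (x i) (x i.+1).
Proof.
move=> [adj can1]; elim: i => [|i IH] il.
  by apply: last_step0; have [] := adj 0 il.
apply: last_stepS (IH _) (can1 _ _) => //; last by ilia.
by have [] := adj i.+1 il.
Qed.

(** Locally normal paths are normal, and lie in each apartment that contains their
    ends: starting from the end, last_step_chart recovers one vertex at a time. *)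
Theorem straight_chart l (x : nat -> V) h k p d : straight l x -> is_chart k -> normal h d ->
  k p = x 0%N -> k (p + d) = x l ->
  h = l /\ forall i, (i <= l)%N -> x i = k (p + cap i d).
Proof.
move=> sx ck nd kp kpd.
have hl : h = l.
  case: l sx kpd => [|l] sx kpd; last first.
    by have [] := last_step_chart (straight_last_step sx (ltnSn l)) ck nd kp kpd.
  have : near 0 p (p + d) by apply/(chart_eq ck); rewrite kp kpd.
  by move/near_add0/(normal_near nd); ilia.
subst h; split=> // i il.
have [j ->] : exists j, i = (l - j)%N by exists (l - i)%N; ilia.
elim: j => [|j IH]; first by rewrite subn0 (cap_full nd) kpd.
have [lj|lj] := leqP l j; first by move: IH; congr (x _ = k (p + cap _ d)); ilia.
have e : (l - j)%N = (l - j.+1).+1 by ilia.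
have c : last_step (l - j.+1) (x 0%N) (x (l - j.+1)%N) (x (l - j.+1).+1).
  by apply: straight_last_step sx _; ilia.
have nt : normal (l - j)%N (cap (l - j) d) by apply: (normal_cap nd); ilia.
have [_ ->] := last_step_chart c ck nt kp (etrans (esym IH) (congr1 x e)).
by rewrite cap_cap //; ilia.
Qed.

Lemma chart_straight k p d h : is_chart k -> normal h d ->
  straight h (fun i => k (p + cap i d)).
Proof.
move=> ck nd; have [hd [a da] [b db]] := nd; split=> i ih.
  split; first exact: chart_path_adj.
  by move/(chart_eq ck)/(_ b a); rewrite !(vecE, ffunE) da db; ilia.
exists k, (p + cap i d), (cap i.+2 d - cap i d); split=> //.
- split; [|exists a|exists b]; rewrite ?(vecE, ffunE) ?da ?db; try ilia.
  by move=> r; rewrite !(vecE, ffunE); have := hd r; ilia.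
- by congr (k _); apply: vecP=> r; rewrite !(vecE, ffunE); have := hd r; ilia.
- by congr (k _); apply: vecP=> r; rewrite !(vecE, ffunE); have := hd r; ilia.
Qed.

(** Reversing the path replaces d by 2 - d. *)
Lemma last_step1_sym x y z : last_step 1 x y z -> last_step 1 z y x.
Proof.
move=> [k [p [d [ck nd <- <- <-]]]]; have [hd [a da] [b db]] := nd.
exists k, (p + d), [ffun r => 2 - d r]; split=> //.
- split; [|exists b|exists a]; rewrite ?(vecE, ffunE) ?da ?db //.
  by move=> r; rewrite !(vecE, ffunE); have := hd r; ilia.
- by apply/(chart_eq ck) => r s; rewrite !(vecE, ffunE); have := hd r; have := hd s; ilia.
- by apply/(chart_eq ck) => r s; rewrite !(vecE, ffunE); ilia.
Qed.

(** The spread of d' - d is at most 2 and both have minimum 0, so they differ by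
    at most 2 in each coordinate, and so do their truncations. This contributes at
    most 4 to the spread, and the difference of the origins at most 1. *)
Lemma cap_near p p' d d' h h' t : normal h d -> normal h' d' ->
  near 1 p p' -> near 1 (p + d) (p' + d') ->
  near 5 (p + cap t d) (p' + cap t d').
Proof.
move=> [hd [a da] _] [hd' [a' da'] _] np nq.
have e r : -2 <= d' r - d r <= 2.
  have := np r a; have := nq r a; have := np a r; have := nq a r.
  have := np r a'; have := nq r a'; have := np a' r; have := nq a' r.
  have := hd a'; have := hd' a; have := hd r; have := hd' r.
  rewrite !(vecE, ffunE) da da'; ilia.
move=> r s; rewrite !(vecE, ffunE); have := e r; have := e s; have := np r s; ilia.
Qed.

End Charts.

(** * Coordinates in the Coxeter complex *)

Section Coordinates.
Local Open Scope ring_scope.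
Variables (n : nat) (hn : (2 <= n)%N) (W : groupType) (s : 'I_n.+1 -> W).
Hypothesis hcox : coxeter_system (@affineA n) s.
Notation m := (n.+1%:Z).
Notation vec := {ffun 'I_n.+1 -> int}.
Implicit Types (i j r : 'I_n.+1) (k a : int) (f : int -> int) (w : W) (p q : vec).
Local Notation zact := (zact hcox).

(** The lower set w {k <= a} is closed under subtraction of m, hence given by
    its largest element r + c * m in each residue class; c is the coordinate at r.
    Adding m to a adds the constant vector 1 and leaves the vertex unchanged. *)
Definition loc w a : vec := [ffun r : 'I_n.+1 => ((a - zact w^-1%g r%:Z) %/ m)%Z].

Lemma locE w a r : loc w a r = ((a - zact w^-1%g r%:Z) %/ m)%Z.
Proof. by rewrite ffunE. Qed.

Lemma zact_periodic w : periodic n (zact w).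
Proof. by have [] := zact_affine_perm hn hcox w. Qed.

Lemma le_loc w a r c : (zact w^-1%g (r%:Z + c * m) <= a) = (c <= loc w a r).
Proof.
rewrite (periodicM _ _ (zact_periodic _)) locE lez_divRL //.
by move: (zact _ _) (c * m) => x y; ilia.
Qed.

Lemma loc_vertex w w' a : loc w a = loc w' a <->
  coxeter_vertex s w (ord_of n a) = coxeter_vertex s w' (ord_of n a).
Proof.
rewrite (vertex_eq hn hcox) ord_ofE.
have [q aq] := resP n a.
have shift_le v k : (zact v k <= (a %% m)%Z) = (zact v (k + q * m) <= a).
  rewrite (periodicM _ _ (zact_periodic _)) [in RHS]aq.
  by move: (zact _ _) (_ %% _)%Z (q * m) => x y z; ilia.
split=> [e k|h].
  rewrite !shift_le.
  have [c ->] := resP n (k + q * m); rewrite [c * m + _]addrC -ord_ofE !le_loc.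
  by rewrite e.
apply: vecP => r.
have le_iff c : (c <= loc w a r) = (c <= loc w' a r).
  rewrite -!le_loc -[_ + _](addrNK (q * m)) -!shift_le; exact: h.
have := le_iff (loc w a r); have := le_iff (loc w' a r).
by move: (loc w a r) (loc w' a r) => x y; rewrite !lexx => h1 h2; ilia.
Qed.

Lemma sum_div_wact (u : seq 'I_n.+1) a : \sum_(r < n.+1) ((a - wact u r%:Z) %/ m)%Z = a - n%:Z.
Proof.
elim/last_ind: u => [|u i <-]; first exact: sum_div_id.
pose F k v := ((a - v) %/ m)%Z + (k %/ m)%Z.
have pF k v : F (k + m) (v + m) = F k v.
  rewrite /F (_ : a - (v + m) = -1 * m + (a - v)); last by ilia.
  rewrite (_ : k + m = 1 * m + k); last by ilia.
  by rewrite !divzMDl //; ilia.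
have := sum_swap hn i pF (@wact_periodic n u).
rewrite /F !big_split /=.
under eq_bigr do rewrite -[wact u (swap i _)]/(wact u (wact [:: i] _)) -wact_cat cats1.
move: (\sum_(r < _) _) (\sum_(r < _) _) (\sum_(r < _) _) => X Y Z; ilia.
Qed.

(** The index a is read off from the vector, so the type of a vertex is its
    coordinate sum, up to a constant. *)
Lemma loc_sum w a : \sum_r loc w a r = a - n%:Z.
Proof.
have [u e] := wprod_surj hcox w^-1%g.
by rewrite -(sum_div_wact u) -(zact_prod hn hcox) -e; apply: eq_bigr => r _; rewrite locE.
Qed.

Lemma loc_near w a b : `|a - b| <= m -> near 1 (loc w a) (loc w b).
Proof.
wlog ab : a b / a <= b.
  move=> h; have [|/ltW ba] := leP a b; first exact: h.
  by rewrite distrC => H; apply/near_sym/(h _ _ ba H).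
move=> hab r t; rewrite !locE; move: (zact _ _) (zact _ _) => x y.
have hx := @div_step n (a - x) (b - x); have hy := @div_step n (a - y) (b - y).
have {}hx := hx ltac:(lia); have {}hy := hy ltac:(lia).
by move: hx hy; move: (_ %/ _)%Z (_ %/ _)%Z (_ %/ _)%Z (_ %/ _)%Z => X Y Z T; ilia.
Qed.

(** The permutation f is prescribed by p and by a ranking l of the residues in
    which those of S come last: increasing a by the size of S moves exactly these
    past a multiple of m. *)
Lemma chamber_ex p (S : {set 'I_n.+1}) : exists w,
  (forall r, loc w (\sum_r p r + n%:Z) r = p r) /\
  (forall r, loc w (\sum_r p r + n%:Z + #|S|%:Z) r = p r + (r \in S)%:Z).
Proof.
pose a : int := \sum_r p r + n%:Z.
pose l := enum (~: S)%SET ++ enum S.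
have ul : uniq l.
  rewrite cat_uniq !enum_uniq andbT /=; apply/hasPn => r.
  by rewrite !mem_enum finset.inE => ->.
have inl r : r \in l by rewrite mem_cat !mem_enum finset.inE orNb.
have sl : size l = n.+1.
  by rewrite -(card_uniqP ul) -[RHS]card_ord; apply: eq_card => r; rewrite inl.
have hl r : (index r l < n.+1)%N.
  by have := inl r; rewrite -index_mem; move: (index r l) => x; rewrite sl.
pose f (k : int) : int := a - m * p (ord_of n k) - (index (ord_of n k) l)%:Z + (k %/ m)%Z * m.
have ofr r : ord_of n r%:Z = r.
  by apply: val_inj; apply/eqP; rewrite -eqz_nat ord_ofE modz_small //; have := ltn_ord r; ilia.
have fr r : f r%:Z = a - m * p r - (index r l)%:Z.
  by rewrite /f ofr divz_small ?mul0r ?addr0 //; have := ltn_ord r; ilia.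
have gf : affine_perm n f.
  split.
  - move=> k; rewrite /f (_ : ord_of n (k + m) = ord_of n k); last by rewrite /ord_of modzDr.
    rewrite (_ : k + m = 1 * m + k) ?divzMDl //; last by ilia.
    by rewrite mulrDl mul1r; move: (p _) (_ %/ _)%Z => x y; ilia.
  - move=> k k' e.
    have e1 : index (ord_of n k) l = index (ord_of n k') l.
      have e2 x : ((a - f x) %% m)%Z = (index (ord_of n x) l)%:Z.
        rewrite (_ : a - f x = (p (ord_of n x) - (x %/ m)%Z) * m + (index (ord_of n x) l)%:Z).
          by rewrite res_eq //; have := hl (ord_of n x); ilia.
        by rewrite /f mulrBl; move: (p _) (_ %/ _)%Z => X Y; ilia.
      by apply/eqP; rewrite -eqz_nat -!e2 e.
    have e2 : ord_of n k = ord_of n k' by rewrite -(nth_index ord0 (inl (ord_of n k))) e1 nth_index.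
    have e3 : (k %% m)%Z = (k' %% m)%Z by rewrite -!ord_ofE e2.
    by move: e; rewrite /f e2 => /addrI e4; rewrite (divz_eq k m) (divz_eq k' m) e3 e4.
  - have e1 : \sum_r (index r l)%:Z = \sum_(r < n.+1) r%:Z :> int.
      rewrite (reindex (fun r => nth ord0 l r)) /=.
        by apply: eq_bigr => r _; rewrite index_uniq // sl.
      exists (fun r => inord (index r l)) => r _; last by rewrite inordK ?nth_index.
      by rewrite index_uniq ?inord_val // sl.
    rewrite (eq_bigr (fun r => a - (m * p r + (index r l)%:Z + r%:Z))); last first.
      by move=> r _; rewrite fr; move: (p _) => x; ilia.
    rewrite sumrB sum_const_int !big_split /= -mulr_sumr e1.
    have := sum_ord n; rewrite sumrMnl -mulr_natr /a.
    move: (\sum_(r < n.+1) r%:Z) => S1; move: (\sum_r p r) => S2; ilia.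
have [w0 hw0] := zact_surj hn hcox gf.
exists (w0^-1)%g; rewrite -/a; split=> r; rewrite locE invgK hw0 fr.
  rewrite (_ : _ - _ = p r * m + (index r l)%:Z) ?div_eq //; first by have := hl r; ilia.
  by move: (p r) => x; ilia.
have hr : (r \in S) = (n.+1 <= index r l + #|S|)%N.
  have cS : (#|S| + #|~: S| = n.+1)%N by rewrite cardsC card_ord.
  rewrite index_cat mem_enum finset.inE; case: (boolP (r \in S)) => rS /=.
    by rewrite -cardE; move: cS; move: #|S| #|~: S| (index _ _) => x y z c; apply/esym; ilia.
  have : (index r (enum (~: S)%SET) < size (enum (~: S)%SET))%N.
    by rewrite index_mem mem_enum finset.inE.
  by rewrite -cardE; move: cS; move: #|S| #|~: S| (index _ _) => x y z c; ilia.
rewrite hr; have := hl r; have := max_card S; rewrite card_ord => h1 h2.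
case: (boolP (n.+1 <= _)%N) => h /=.
  rewrite (_ : _ - _ = (p r + 1) * m + ((index r l)%:Z + #|S|%:Z - m)) ?div_eq //.
    by move: h h1 h2; move: #|S| (index r l) => x y; ilia.
  by move: (p r) #|S| => x c; ilia.
rewrite (_ : _ - _ = p r * m + ((index r l)%:Z + #|S|%:Z)) ?div_eq ?addr0 //.
  by move: h h1 h2; move: #|S| (index r l) => x y; ilia.
by move: (p r) #|S| => x c; ilia.
Qed.

End Coordinates.

(** * Apartments, retractions and charts *)

Section Building.
Local Open Scope ring_scope.
Local Open Scope classical_set_scope.
Variables (n : nat) (hn : (2 <= n)%N) (V : Type) (D : set (set V)) (tau : V -> 'I_n.+1).
Variables (W : groupType) (s : 'I_n.+1 -> W).
Hypothesis hcox : coxeter_system (@affineA n) s.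
Notation m := (n.+1%:Z).
Notation vec := {ffun 'I_n.+1 -> int}.
Implicit Types (i j r t : 'I_n.+1) (k a b : int) (w x y : W) (p q : vec) (X Y : set (set V)).
Notation zact := (zact hcox).
Notation loc := (loc hcox).
Notation cv := (coxeter_vertex s).

Lemma vertex_left x w w' i : cv w i = cv w' i -> cv (x * w)%g i = cv (x * w')%g i.
Proof.
move=> /(vertex_eq hn hcox) h; apply/(vertex_eq hn hcox) => k.
by rewrite !invgM !zactM // h.
Qed.

Lemma vertex_s w i j : j != i -> cv (w * s i)%g j = cv w j.
Proof.
move=> ji; rewrite -[in RHS](mulg1 w); apply: vertex_left; apply/(vertex_eq hn hcox) => k.
have : stab hcox j (s i).
  by apply/(stab_parabolic hn); exists [:: i]; rewrite ?big_cons ?big_nil ?mulg1 //= eq_sym ji.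
by rewrite sV // invg1 zact1 //; apply.
Qed.

Lemma vertex_s_neq w i : cv (w * s i)%g i <> cv w i.
Proof.
move=> /(vertex_left w^-1); rewrite mulKg mulVg => /(vertex_eq hn hcox) /(_ i%:Z).
rewrite sV // invg1 zact1 // zact_s // swap_at; ilia.
Qed.

Lemma loc_addM w a (c : int) r : loc w (a + c * m) r = loc w a r + c.
Proof.
rewrite !locE (_ : a + c * m - _ = c * m + (a - zact w^-1%g r%:Z)); last first.
  by move: (zact _ _) (c * m) => u v; ilia.
by rewrite divzMDl // addrC.
Qed.

Lemma near0_const p q : near 0 p q -> exists c, forall r, q r = p r + c.
Proof.
move=> h; exists (q ord0 - p ord0) => r.
by have := h r ord0; have := h ord0 r; ilia.
Qed.

(** The vectors modulo constants are the vertices of the Coxeter complex. *)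
Lemma near0_loc w w' a a' : near 0 (loc w a) (loc w' a') <->
  ord_of n a = ord_of n a' /\ cv w (ord_of n a) = cv w' (ord_of n a).
Proof.
have ofM c : ord_of n (a + c * m) = ord_of n a by rewrite /ord_of addrC modzMDl.
split=> [/near0_const [c hc]|[e1 e2]].
  have ea : a' = a + c * m.
    have := loc_sum hn hcox w' a'; have := loc_sum hn hcox w a.
    rewrite (eq_bigr (fun r => loc w a r + c) (fun r _ => hc r)) big_split /= sum_const_int => ->.
    by ilia.
  rewrite ea ofM; split=> //; rewrite -(ofM c); apply/(loc_vertex hn).
  by apply: vecP => r; rewrite loc_addM -hc ea.
have [c ea] : exists c : int, a' = a + c * m.
  have := congr1 (fun i : 'I_n.+1 => i%:Z) e1; rewrite !ord_ofE //.
  move=> e; exists ((a' %/ m)%Z - (a %/ m)%Z); have := divz_eq a m; have := divz_eq a' m.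
  rewrite e mulrBl; move: (_ %% _)%Z ((a' %/ m)%Z * m) ((a %/ m)%Z * m) => t u v; ilia.
move: e2; rewrite -(ofM c) => /(loc_vertex hn) e2 r t.
have := loc_addM w a c; rewrite e2 -ea => h.
by rewrite !h; ilia.
Qed.

(** An identification of X with the Coxeter complex, preserving types. *)
Definition marking (X : set (set V)) (f : set W -> V) : Prop :=
  isomorphism (coxeter_complex s) X f /\ (forall w i, tau (f (cv w i)) = i).

Lemma coxeter_vertexP w i : vertices (coxeter_complex s) (cv w i).
Proof. by exists w => _ ->; exists i. Qed.

Lemma marking_inj X f w w' i j : marking X f -> f (cv w i) = f (cv w' j) ->
  i = j /\ cv w i = cv w' i.
Proof.
move=> [[injf _] tf] e; have ij : i = j by rewrite -(tf w i) e tf.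
by subst j; split=> //; apply: injf => //; apply/mem_set; apply: coxeter_vertexP.
Qed.

Lemma marking_simplex X f S : marking X f ->
  X S <-> exists w, forall v, S v -> exists i, v = f (cv w i).
Proof.
move=> [[_ <-] _]; split=> [[T [w hw] <-]|[w hw]].
  by exists w => _ [u /hw [i _ <-] <-]; exists i.
exists [set u | S (f u) /\ range (cv w) u].
  by exists w => u [].
apply/seteqP; split=> [_ [u [h _] <-] //|v Sv].
have [i e] := hw v Sv; exists (cv w i); last by [].
by split; [rewrite /= -e | exists i].
Qed.

Lemma marking_vertex X f w i : marking X f -> vertices X (f (cv w i)).
Proof. by move=> mf; apply/(marking_simplex _ mf); exists w => _ ->; exists i. Qed.

(** Go along galleries: the image of the next chamber contains the panel shared
    with the previous one, and by thinness there are only two chambers that do,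
    one of which is already taken by injectivity. *)
Lemma rigidity X Y f f' g w w' : marking X f -> marking Y f' -> isomorphism X Y g ->
  (forall i, g (f (cv w i)) = f' (cv w' i)) ->
  forall x i, g (f (cv (w * x)%g i)) = f' (cv (w' * x)%g i).
Proof.
move=> mf mf' [injg img] e x.
have [u ->] := wprod_surj hcox x.
elim/last_ind: u => [|u l IH] i; first by rewrite big_nil !mulg1.
rewrite wprod_rcons !mulgA.
move: (w * _)%g (w' * _)%g IH => y z IH.
have [->|il] := eqVneq i l; last by rewrite !vertex_s.
pose S : set V := range (fun j => f (cv (y * s l)%g j)).
have YS : Y (g @` S).
  rewrite -img; exists S => //.
  by apply/(marking_simplex _ mf); exists (y * s l)%g => _ [j _ <-]; exists j.
have [t ht] := (marking_simplex _ mf').1 YS.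
have ginj (a b : 'I_n.+1) v v' : g (f (cv v a)) = g (f (cv v' b)) -> a = b /\ cv v a = cv v' a.
  move=> h; apply: (marking_inj mf); apply: injg h; apply/mem_set; exact: marking_vertex mf.
have gy j : j != l -> g (f (cv (y * s l)%g j)) = f' (cv z j).
  by move=> jl; rewrite vertex_s.
have tz : forall j, j != l -> cv z j = cv t j.
  move=> j jl; have [|j' e'] := ht (g (f (cv (y * s l)%g j))).
    by exists (f (cv (y * s l)%g j)) => //; exists j.
  by move: e'; rewrite gy // => /(marking_inj mf') [].
have [|j ej] := ht (g (f (cv (y * s l)%g l))).
  by exists (f (cv (y * s l)%g l)) => //; exists l.
have jl : j = l.
  apply/eqP; apply: contraT => jl; move: ej; rewrite -tz // -gy // => /ginj [lj _].
  by rewrite -lj eqxx in jl.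
subst j; rewrite ej.
have [tz'|-> //] := vertex_panel hn hcox tz.
by move: ej; rewrite tz' -IH => /ginj [_ /vertex_s_neq].
Qed.

Variables (apartments : set (set (set V))).
Hypothesis vertD : vertices D = setT.
Hypothesis apartD : forall X, apartments X -> X `<=` D.
Hypothesis mark : forall X, apartments X -> exists f, marking X f.
Hypothesis join : forall S T, D S -> D T -> exists2 X, apartments X & X S /\ X T.
Hypothesis overlap : forall X Y S T, apartments X -> apartments Y ->
  X S -> X T -> Y S -> Y T ->
  exists f : V -> V, isomorphism X Y f /\ (forall v, (S `|` T) v -> f v = v).

Section Chart.
Variables (X : set (set V)) (f : set W -> V).
Hypothesis (aX : apartments X) (mf : marking X f).

Definition chamber_at w : set V := range (fun i => f (cv w i)).

(** The graph of the retraction onto X centred at the chamber w0: a vertex v of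
    an apartment Y that contains this chamber is sent to the vertex of X in the
    same position with respect to it. The value is given in coordinates. *)
Definition retracts w0 (v : V) (q : vec) : Prop :=
  exists Y f' w' x a, [/\ apartments Y, marking Y f',
    forall i, f (cv w0 i) = f' (cv w' i),
    v = f' (cv (w' * x)%g (ord_of n a)) & q = loc (w0 * x)%g a].

Lemma chamber_in w0 : X (chamber_at w0).
Proof. by apply/(marking_simplex _ mf); exists w0 => _ [i _ <-]; exists i. Qed.

Lemma D_point v : D [set v].
Proof. by have : vertices D v by rewrite vertD. Qed.

Lemma common_chamber w0 Y f' : marking Y f' -> Y (chamber_at w0) ->
  exists w', forall i, f (cv w0 i) = f' (cv w' i).
Proof.
move=> mf' /(marking_simplex _ mf') [w' hw']; exists w' => i.
have [|j e] := hw' (f (cv w0 i)); first by exists i.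
rewrite e; congr (f' (cv _ _)).
by have [_ t] := mf; have [_ t'] := mf'; rewrite -(t w0 i) e t'.
Qed.

Lemma retracts_edge w0 v v' : D [set v; v'] ->
  exists q q', [/\ retracts w0 v q, retracts w0 v' q' & near 1 q q'].
Proof.
move=> Dvv'; have [Y aY [YC Yv]] := join (apartD aX (chamber_in w0)) Dvv'.
have [f' mf'] := mark aY; have [w' hw'] := common_chamber mf' YC.
have [y hy] := (marking_simplex _ mf').1 Yv.
have [i ei] := hy v (or_introl erefl); have [j ej] := hy v' (or_intror erefl).
exists (loc (w0 * (w'^-1 * y))%g i%:Z), (loc (w0 * (w'^-1 * y))%g j%:Z); split.
- by exists Y, f', w', (w'^-1 * y)%g, i%:Z; rewrite mulVKg ord_of_id.
- by exists Y, f', w', (w'^-1 * y)%g, j%:Z; rewrite mulVKg ord_of_id.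
- by apply: loc_near; have := ltn_ord i; have := ltn_ord j; ilia.
Qed.

Lemma retracts_ex w0 v : exists q, retracts w0 v q.
Proof.
have [|q [_ [h _ _]]] := @retracts_edge w0 v v; last by exists q.
by rewrite setUid; exact: D_point.
Qed.

(** Two apartments that contain v and the central chamber are isomorphic by a map
    fixing both, and by rigidity this map preserves positions. *)
Lemma retracts_unique w0 v q q' : retracts w0 v q -> retracts w0 v q' -> near 0 q q'.
Proof.
move=> [Y [f1 [w1 [x1 [a1 [aY m1 h1 e1 ->]]]]]] [Z [f2 [w2 [x2 [a2 [aZ m2 h2 e2 ->]]]]]].
have inC T f' w' : marking T f' -> (forall i, f (cv w0 i) = f' (cv w' i)) -> T (chamber_at w0).
  by move=> mT h; apply/(marking_simplex _ mT); exists w' => _ [i _ <-]; exists i.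
have Yv : Y [set v] by rewrite e1; exact: (marking_vertex _ _ m1).
have Zv : Z [set v] by rewrite e2; exact: (marking_vertex _ _ m2).
have [g [ig fixg]] := overlap aY aZ (inC _ _ _ m1 h1) Yv (inC _ _ _ m2 h2) Zv.
have gC i : g (f1 (cv w1 i)) = f2 (cv w2 i).
  by rewrite -h1 -h2; apply: fixg; left; exists i.
have := rigidity m1 m2 ig gC x1 (ord_of n a1).
rewrite -e1 fixg; last by right.
rewrite e2 => /esym /(marking_inj m2) [ea ev]; apply/near0_loc; split=> //.
by have := vertex_left (w0 * w2^-1)%g ev; rewrite -!mulgA !mulKg.
Qed.

Lemma retracts_type w0 v q : retracts w0 v q ->
  exists a, \sum_r q r = a - n%:Z /\ (tau v)%:Z = (a %% m)%Z.
Proof.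
move=> [Y [f' [w' [x [a [_ [_ t] _ -> ->]]]]]]; exists a.
by rewrite loc_sum // t ord_ofE.
Qed.

(** By loc_vertex the choice of the chamber does not matter. *)
Definition chart (p : vec) : V :=
  f (cv (projT1 (cid (chamber_ex hn hcox p (finset.set0)))) (ord_of n (\sum_r p r + n%:Z))).

Lemma chart_loc w a : chart (loc w a) = f (cv w (ord_of n a)).
Proof.
rewrite /chart; case: cid => /= w' [h _]; move: h; rewrite loc_sum // subrK => h.
by congr f; apply/(loc_vertex hn); apply: vecP.
Qed.

Lemma loc_surj p : exists w a, p = loc w a.
Proof.
have [w [h _]] := chamber_ex hn hcox p finset.set0.
by exists w, (\sum_r p r + n%:Z); apply: vecP => r; rewrite h.
Qed.

Lemma near1_set p q : near 1 p q -> exists (S : {set 'I_n.+1}) c,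
  forall r, q r = p r + (r \in S)%:Z + c.
Proof.
move=> h; pose g r := q r - p r.
have [lo hlo] : exists lo, forall r, g lo <= g r.
  case: (@Order.TotalTheory.arg_minP _ _ 'I_n.+1 ord0 xpredT g isT) => i _ hi.
  by exists i => r; exact: hi.
exists [set r | g r == g lo + 1]%SET, (g lo) => r; rewrite finset.inE.
have := hlo r; have := h r lo; rewrite /g.
by case: eqP; ilia.
Qed.

Lemma chart_is_chart : is_chart D tau chart.
Proof.
have eqc p q : chart p = chart q <-> near 0 p q.
  have [w [a ->]] := loc_surj p; have [w' [a' ->]] := loc_surj q.
  rewrite !chart_loc near0_loc; split=> [/(marking_inj mf)//|[<- ->]//].
split=> // [p q pq|p].
  have [S [c hc]] := near1_set pq.
  have [w [h1 h2]] := chamber_ex hn hcox p S.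
  have -> : p = loc w (\sum_r p r + n%:Z) by apply: vecP => r; rewrite h1.
  have -> : chart q = chart (loc w (\sum_r p r + n%:Z + #|S|%:Z)).
    apply/eqc => r t; rewrite !h2 !hc; move: (r \in S) (t \in S) => u v; ilia.
  rewrite !chart_loc; apply: (apartD aX); apply/(marking_simplex _ mf); exists w.
  move=> v [->|->]; first by exists (ord_of n (\sum_r p r + n%:Z)).
  by exists (ord_of n (\sum_r p r + n%:Z + #|S|%:Z)).
have [w0 [a0 pE]] := loc_surj p.
pose rho v := projT1 (cid (retracts_ex w0 v)).
have rhoP v : retracts w0 v (rho v) by rewrite /rho; case: cid.
exists rho; split.
- move=> q; apply: (retracts_unique (rhoP _)).
  have [w [a ->]] := loc_surj q; rewrite chart_loc.
  by exists X, f, w0, (w0^-1 * w)%g, a; rewrite mulVKg.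
- move=> v v' /(retracts_edge w0) [q [q' [hq hq' qq']]].
  apply: (near_trans (l1 := 0) (l2 := 1)) (retracts_unique (rhoP _) hq) _ => //.
  exact: (near_trans (l1 := 1) (l2 := 0)) qq' (retracts_unique hq' (rhoP _)).
- move=> v v'; rewrite /typediff.
  have [a [-> ->]] := retracts_type (rhoP v); have [b [-> ->]] := retracts_type (rhoP v').
  apply/dvdzP; exists ((a %/ m)%Z - (b %/ m)%Z); rewrite mulrBl.
  have := divz_eq a m; have := divz_eq b m.
  by move: (_ * m) (_ * m) (_ %% m)%Z (_ %% m)%Z => A B C E; ilia.
- move=> v; have [Y [f' [w' [x [a [aY mf' h -> ->]]]]]] := rhoP v.
  rewrite pE near0_loc chart_loc => -[<- e]; rewrite h; congr f'.
  by have := vertex_left (w' * w0^-1)%g e; rewrite -!mulgA mulKg mulVg mulg1.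
Qed.

Lemma chart_onto v : vertices X v -> exists p, chart p = v.
Proof.
move=> /(marking_simplex _ mf) [w h]; have [i ->] := h v erefl.
by exists (loc w i%:Z); rewrite chart_loc ord_of_id.
Qed.

End Chart.

Lemma chart_through (v y z : V) : D [set y; z] ->
  exists (k : {ffun 'I_n.+1 -> int} -> V) p q u, [/\ is_chart D tau k, k p = v, k q = y & k u = z].
Proof.
move=> Dyz; have [X aX [Xv Xyz]] := join (D_point v) Dyz.
have [f mf] := mark aX.
have sub (t : V) : [set y; z] t -> vertices X t.
  move=> ht; apply/(marking_simplex _ mf); have [w h] := (marking_simplex _ mf).1 Xyz.
  by exists w => _ ->; exact: h.
have [p <-] := chart_onto mf Xv.
have [q <-] := chart_onto mf (sub y (or_introl erefl)).
have [u <-] := chart_onto mf (sub z (or_intror erefl)).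
by exists (chart f), p, q, u; split=> //; apply: chart_is_chart aX mf.
Qed.

End Building.

Section BuildingCharts.
Local Open Scope classical_set_scope.
Variables (n : nat) (hn : 2 <= n) (V : Type) (D : set (set V)) (tau : V -> 'I_n.+1).
Hypothesis hD : building (@affineA n) D tau.

Lemma building_chart x y z : D [set y; z] ->
  exists (k : {ffun 'I_n.+1 -> int} -> V) p q u, [/\ is_chart D tau k, k p = x, k q = y & k u = z].
Proof.
have [_ [vD [W [s [ap [hc hA hj ho]]]]]] := hD.
apply: (chart_through hn hc (apartments := ap) vD) => //.
- by move=> X /hA [_ h _].
- by move=> X /hA [_ _ [f hf]]; exists f.
Qed.

Lemma building_nonempty : exists v : V, True.
Proof.
have [[D0 _ _] [_ [W [s [ap [_ hA hj _]]]]]] := hD.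
have [X aX _] := hj _ _ D0 D0; have [_ _ [f _]] := hA X aX.
by exists (f set0).
Qed.

End BuildingCharts.

(** * The language of normal paths *)

Section Words.
Variables (G : groupType) (A : {fset G}).
Implicit Types (u v : seq G) (g : G).

Lemma eval_cat u v : eval (u ++ v) = (eval u * eval v)%g.
Proof. by rewrite /eval big_cat. Qed.

Lemma eval_seq1 g : eval [:: g] = g.
Proof. by rewrite /eval big_cons big_nil mulg1. Qed.

Lemma prefix_eval0 u : prefix_eval u 0 = 1%g.
Proof. by rewrite /prefix_eval take0 /eval big_nil. Qed.

Lemma prefix_evalS u i : i < size u -> prefix_eval u i.+1 = (prefix_eval u i * nth 1%g u i)%g.
Proof. by move=> hi; rewrite /prefix_eval (take_nth 1%g) // -cats1 eval_cat eval_seq1. Qed.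

Lemma prefix_eval_ge u t : size u <= t -> prefix_eval u t = eval u.
Proof. by move=> h; rewrite /prefix_eval take_oversize. Qed.

Lemma word_length_min u : all (mem A) u ->
  word_lengths A (eval u) (word_length A (eval u)) /\ word_length A (eval u) <= size u.
Proof.
move=> Au.
pose P := [set k | word_lengths A (eval u) k /\
  forall l, word_lengths A (eval u) l -> k <= l]%classic.
have wu : word_lengths A (eval u) (size u) by exists u.
have exP : exists k, P k.
  have ex : exists k, `[< word_lengths A (eval u) k >] by exists (size u); apply/asboolP.
  case: (ex_minnP ex) => k /asboolP hk hmin; exists k; split=> // l hl.
  by apply: hmin; apply/asboolP.
have [h1 h2] := xgetPex 0 exP; split; [exact: h1 | exact: (h2 _ wu)].
Qed.

(** The states remember the last letter: None is the dead state, Some None the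
    initial one. *)
Lemma regular_sorted (r : rel G) : regular A [set u | all (mem A) u /\ sorted r u]%classic.
Proof.
pose delta (q : option (option A)) (x : G) : option (option A) :=
  match q with
  | None => None
  | Some None => Some (insub x)
  | Some (Some a) => if r (val a) x then Some (insub x) else None
  end.
exists (option (option A)), (Some None), delta, (fun q => q != None) => u.
have dead v : foldl delta None v = None by elim: v.
have run (a : A) v : all (mem A) v -> (foldl delta (Some (Some a)) v != None) = path r (val a) v.
  elim: v a => [//|x v IH] a /= /andP [xA vA].
  case: ifP => _ /=; last by rewrite dead.
  by rewrite insubT IH.
split=> -[uA]; case: u uA => [//|x u] /= /andP [xA uA].
  by rewrite (insubT (mem A) xA) run // xA uA.
by rewrite (insubT (mem A) xA) run // xA uA.
Qed.

End Words.

Section Group.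
Local Open Scope classical_set_scope.
Variables (n : nat) (V : Type) (D : set (set V)) (tau : V -> 'I_n.+1).
Notation vec := {ffun 'I_n.+1 -> int}.
Variables (G : groupType) (act : G -> V -> V) (o : V).
Hypothesis hvert : vertices D = setT.
Hypothesis hfin : locally_finite D.
Hypothesis hact : acts_on D act.
Hypothesis htrans : simply_transitive act.
Hypothesis hrot : forall g, type_rotating tau (act g).
Hypothesis ex_chart : forall x y z, D [set y; z] ->
  exists (k : vec -> V) p q u, [/\ is_chart D tau k, k p = x, k q = y & k u = z].
Implicit Types (g a b : G) (x y z : V) (u v : seq G).

Lemma act1 x : act 1%g x = x. Proof. by have [-> ] := hact. Qed.
Lemma actM g h x : act (g * h)%g x = act g (act h x). Proof. by have [_ -> ] := hact. Qed.
Lemma actK g x : act g^-1%g (act g x) = x. Proof. by rewrite -actM mulVg act1. Qed.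
Lemma actVK g x : act g (act g^-1%g x) = x. Proof. by rewrite -actM mulgV act1. Qed.

Lemma act_simplex g x y : D [set x; y] -> D [set act g x; act g y].
Proof.
move=> h; have [_ _ /(_ g) [_ <-]] := hact; exists [set x; y] => //.
by rewrite image_setU !image_set1.
Qed.

Lemma D_refl x : D [set x; x].
Proof. by rewrite setUid; have : vertices D x by rewrite hvert. Qed.

Lemma orbit_ex x : exists g, act g o = x.
Proof. by have [g [h _]] := htrans o x; exists g. Qed.

Lemma orbit_inj g h : act g o = act h o -> g = h.
Proof. by have [k [_ hk]] := htrans o (act h o) => e; rewrite -(hk g e) (hk h erefl). Qed.

Lemma act_typediff g x y p q :
  typediff tau (act g x) (act g y) p q <-> typediff tau x y p q.
Proof.
have [c hc] := hrot g; rewrite /typediff.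
have rot z : exists e : int, ((tau (act g z))%:Z = (tau z)%:Z + c%:Z + e * n.+1%:Z)%R.
  have := hc z; have := divn_eq (tau (act g z)) n.+1; have := divn_eq (tau z + c) n.+1.
  move=> e1 e2 e3; rewrite e3 in e2.
  exists (((tau (act g z)) %/ n.+1)%:Z - ((tau z + c) %/ n.+1)%:Z)%R.
  move: e1 e2.
  move: ((tau z + c) %% n.+1) ((tau z + c) %/ n.+1) (tau (act g z) %/ n.+1) => r q1 q2 e1 e2.
  by rewrite mulrBl; move: e1 e2; ilia.
have [ex ->] := rot x; have [ey ->] := rot y.
split=> /dvdzP [e he]; apply/dvdzP; [exists (e - (ey - ex))%R|exists (e + (ey - ex))%R].
  by rewrite !mulrBl -he; move: (\sum_r _)%R (\sum_r _)%R => X Y; ilia.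
by rewrite mulrDl -he mulrBl; move: (\sum_r _)%R (\sum_r _)%R => X Y; ilia.
Qed.

(** Charts are carried to charts, by conjugating the retractions. *)
Lemma act_chart g k : is_chart D tau k -> is_chart D tau (act g \o k).
Proof.
move=> ck; split.
- move=> p q; rewrite -(chart_eq ck) /=; split=> [e|-> //].
  by rewrite -(actK g (k p)) e actK.
- by move=> p q /(chart_adj ck) /(act_simplex g).
- move=> p; have [rho [h1 h2 h3 h4]] := chart_retract ck p.
  exists (rho \o act g^-1%g); split=> /=.
  + by move=> q; rewrite actK.
  + by move=> x y /(act_simplex g^-1%g) /h2.
  + by move=> x y; apply/(act_typediff g^-1%g); exact: h3.
  + by move=> x /h4 e; rewrite -(actVK g x) e.
Qed.

Lemma act_last_step g h x y z : last_step D tau h x y z ->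
  last_step D tau h (act g x) (act g y) (act g z).
Proof.
move=> [k [p [d [ck nd <- <- <-]]]]; exists (act g \o k), p, d; split=> //; exact: act_chart.
Qed.

Lemma act_straight g l (x : nat -> V) : straight D tau l x -> straight D tau l (act g \o x).
Proof.
move=> [h1 h2]; split=> i il /=; last exact/act_last_step/h2.
have [hD ne] := h1 i il; split; first exact: act_simplex.
by move=> e; apply: ne; rewrite -(actK g (x i)) e actK.
Qed.

Definition neighbour g := g <> 1%g /\ D [set o; act g o].

(** An element g is determined by the edge from o to g o, hence the generators
    inject into the simplices at o. *)
Lemma neighbours_finite : finite_set [set g | neighbour g].
Proof.
pose h (a : set V) : G := xget 1%g [set g | neighbour g /\ a = [set o; act g o]].
have fin : finite_set [set a | D a /\ a o] by apply: hfin; rewrite hvert.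
apply: (sub_finite_set _ (finite_image h fin)) => g /= ng.
exists [set o; act g o]; first by split; [exact: ng.2 | left].
have [[n' Dg'] e] : neighbour (h [set o; act g o]) /\
    [set o; act g o] = [set o; act (h [set o; act g o]) o].
  apply: (@xgetPex _ 1%g [set g' | neighbour g' /\ [set o; act g o] = [set o; act g' o]]).
  by exists g.
apply: orbit_inj.
have : [set o; act g o] (act (h [set o; act g o]) o) by rewrite [in X in X _]e; right.
case=> // e1; case: n'; apply: orbit_inj; by rewrite e1 act1.
Qed.

Definition gens : {fset G} := fset_set [set g | neighbour g].

Lemma gensP g : g \in gens <-> neighbour g.
Proof.
rewrite /gens in_fset_set; last exact: neighbours_finite.
by split=> [/set_mem|h]; [|apply/mem_set].
Qed.

Lemma gensV g : g \in gens -> (g^-1)%g \in gens.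
Proof.
move/gensP => [g1 Dg]; apply/gensP; split.
  by move=> e; apply: g1; rewrite -(invgK g) e invg1.
by have := act_simplex g^-1%g Dg; rewrite actK setUC.
Qed.

(** The path o, a o, a b o is normal. *)
Definition consecutive : rel G := fun a b =>
  `[< last_step D tau 1 o (act a o) (act (a * b)%g o) >].

Definition normal_words : set (seq G) := [set u | all (mem gens) u /\ sorted consecutive u].

Definition vertex_at u t : V := act (prefix_eval u t) o.

Lemma vertex_at_adj u i : all (mem gens) u -> i < size u ->
  D [set vertex_at u i; vertex_at u i.+1] /\ vertex_at u i <> vertex_at u i.+1.
Proof.
move=> uA iu; have /gensP [a1 Da] : nth 1%g u i \in gens by apply: (allP uA); exact: mem_nth.
rewrite /vertex_at prefix_evalS // actM; split; first exact: act_simplex.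
by rewrite -actM => /orbit_inj e; apply: a1; apply: (mulgI (prefix_eval u i)); rewrite mulg1.
Qed.

Lemma normal_words_straight u : normal_words u -> straight D tau (size u) (vertex_at u).
Proof.
move=> [uA us]; split=> i iu; first exact: vertex_at_adj.
have /asboolP c : consecutive (nth 1%g u i) (nth 1%g u i.+1) by move/(sortedP 1%g): us; exact.
have := act_last_step (prefix_eval u i) c.
by rewrite -!actM mulgA -!prefix_evalS //; exact: ltnW.
Qed.

Lemma straight_normal_word l (x : nat -> V) : straight D tau l x -> x 0 = o ->
  exists u, [/\ normal_words u, size u = l & act (eval u) o = x l].
Proof.
move=> [h1 h2] x0.
pose g i := projT1 (cid (orbit_ex (x i))).
have gx i : act (g i) o = x i by rewrite /g; case: cid.
pose a i := ((g i)^-1 * g i.+1)%g.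
have ax i : act (g i) (act (a i) o) = x i.+1 by rewrite -actM /a mulVKg.
exists (mkseq a l); split; last 2 first.
- by rewrite size_mkseq.
- have pre i : i <= l -> eval (mkseq a i) = g i.
    elim: i => [|i IH] il.
      by apply: orbit_inj; rewrite gx x0 /eval big_nil act1.
    by rewrite mkseqS -cats1 eval_cat eval_seq1 (IH (ltnW il)) /a mulVKg.
  by rewrite pre.
split.
  apply/allP => b /mapP [i]; rewrite mem_iota add0n => /= il ->; apply/gensP.
  have [Di ne] := h1 i il; split.
    by move=> e; apply: ne; rewrite -(ax i) e act1.
  by have := act_simplex (g i)^-1%g Di; rewrite -(ax i) -{1}(gx i) !actK.
apply/(sortedP 1%g) => i; rewrite size_mkseq => il.
rewrite !nth_mkseq //; last exact: ltnW.
apply/asboolP; have := act_last_step (g i)^-1%g (h2 i il).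
have gS : g i.+1 = (g i * a i)%g by rewrite /a mulVKg.
by rewrite -(ax i.+1) gS actM -(ax i) -(gx i) !actK actM.
Qed.

(** Translate the normal path between the two vertices to o and read its word. *)
Lemma word_dist_chart k p q g h l : is_chart D tau k ->
  k p = act g o -> k q = act h o -> near l p q -> word_dist gens g h <= l.
Proof.
move=> ck kp kq pq; have [e [d [nd npd]]] := normalize p q.
have el : e <= l.
  apply: (normal_near nd); apply/(near_add0 _ p).
  by apply: (near_trans (l1 := l) (l2 := 0)) pq (near_sym npd); rewrite addn0.
have [|u [[uA _] su eu]] := straight_normal_word (act_straight g^-1%g (chart_straight p ck nd)).
  by rewrite /= (cap0 nd) addr0 kp actK.
have eg : eval u = (g^-1 * h)%g.
  apply: orbit_inj; rewrite eu /= (cap_full nd) actM -kq; congr act.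
  exact/(chart_eq ck).
by rewrite /word_dist -eg; have [_] := word_length_min uA; move/leq_trans; apply; rewrite su.
Qed.

Lemma normal_words_onto g : exists2 u, normal_words u & eval u = g.
Proof.
have [k [p [q [_ [ck kp kq _]]]]] := ex_chart o (D_refl (act g o)).
have [e [d [nd npd]]] := normalize p q.
have [|u [Lu _ eu]] := straight_normal_word (chart_straight p ck nd).
  by rewrite (cap0 nd) addr0.
exists u => //; apply: orbit_inj; rewrite eu (cap_full nd) -kq; exact/(chart_eq ck).
Qed.

(** The path of any other word for the same element is retracted onto an apartment
    that contains its ends, where it cannot be shorter than the normal path. *)
Lemma normal_words_geodesic : geodesic_language gens normal_words.
Proof.
move=> u Lu; have [[v [vA ev sv]] le] := word_length_min Lu.1.
apply/eqP; rewrite eqn_leq le -sv.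
have [k [p [q [_ [ck kp kq _]]]]] := ex_chart o (D_refl (act (eval u) o)).
have [h [d [nd npd]]] := normalize p q.
have kpd : k (p + d)%R = act (eval u) o by rewrite -kq; apply/(chart_eq ck).
have [||hu _] := straight_chart (p := p) ex_chart (normal_words_straight Lu) ck nd.
- by rewrite kp /vertex_at prefix_eval0 act1.
- by rewrite kpd /vertex_at prefix_eval_ge.
rewrite -hu; apply: (normal_near nd); apply/(near_add0 _ p).
have [rho [h1 h2 _ _]] := chart_retract ck p.
have := retract_path h2 (fun i il => (vertex_at_adj vA il).1).
rewrite /vertex_at prefix_eval0 act1 prefix_eval_ge // ev -kpd -kp => H.
apply: (near_trans (l1 := 0) (l2 := size v)) (near_sym (h1 p)) _ => //.
by apply: (near_trans (l1 := size v) (l2 := 0)) H (h1 _); rewrite addn0.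
Qed.

Lemma normal_words_symmetric : symmetric_language normal_words.
Proof.
move=> u [uA us]; split.
  rewrite all_rev all_map; apply: sub_all uA => a /=; exact: gensV.
rewrite rev_sorted sorted_map; apply: sub_sorted us => a b /asboolP c /=; apply/asboolP.
have := act_last_step (a * b)^-1%g (last_step1_sym c).
by rewrite actK -!actM invgM mulgVK.
Qed.

(** Both fellow-traveller properties: for g = 1 the paths start at the same vertex,
    and in the other case they end at the same vertex. *)
Lemma normal_words_fellow k p p' q q' g u v :
  is_chart D tau k -> normal_words u -> normal_words v ->
  k p = o -> k p' = act g o -> k q = act (eval u) o -> k q' = act (g * eval v)%g o ->
  near 1 p p' -> near 1 q q' ->
  forall t, word_dist gens (prefix_eval u t) (g * prefix_eval v t)%g <= 5.
Proof.
move=> ck Lu Lv kp kp' kq kq' pp' qq' t.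
have [h [d [nd npd]]] := normalize p q; have [h' [d' [nd' npd']]] := normalize p' q'.
have path (e : vec) (y : G) w (x0 x1 : vec) (hh : nat) : normal_words w -> normal hh e ->
    k x0 = act y o -> k x1 = act (y * eval w)%g o -> near 0 (x0 + e)%R x1 ->
    k (x0 + cap t e)%R = act (y * prefix_eval w t)%g o.
  move=> Lw ne k0 k1 n1.
  have [||hw hx] :=
    straight_chart (p := x0) ex_chart (act_straight y (normal_words_straight Lw)) ck ne.
  - by rewrite k0 /= /vertex_at prefix_eval0 act1.
  - rewrite /= /vertex_at prefix_eval_ge // -actM -k1; exact/(chart_eq ck).
  have [tw|wt] := leqP t (size w); first by rewrite -hx //= actM.
  rewrite prefix_eval_ge ?(ltnW wt) // -k1 (cap_ge ne) ?hw ?(ltnW wt) //.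
  exact/(chart_eq ck).
apply: (word_dist_chart ck (p := (p + cap t d)%R) (q := (p' + cap t d')%R)).
- by rewrite (path _ 1%g _ _ q _ Lu nd) ?act1 ?mul1g.
- exact: path Lv nd' kp' kq' npd'.
- apply: (cap_near t nd nd' pp').
  apply: (near_trans (l1 := 0) (l2 := 1)) npd _ => //.
  exact: (near_trans (l1 := 1) (l2 := 0)) qq' (near_sym npd').
Qed.

Lemma gens_nonempty : 0 < n -> exists a, a \in gens.
Proof.
move=> n0; have [k [p [_ [_ [ck kp _ _]]]]] := ex_chart o (D_refl o).
pose e : vec := [ffun r : 'I_n.+1 => ((r == ord0)%:Z)%R].
have eE r : e r = ((r == ord0)%:Z)%R by rewrite ffunE.
have [g hg] := orbit_ex (k (p + e)%R); exists g; apply/gensP; split.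
  move=> g1; have /(chart_eq ck)/near_add0 : k p = k (p + e)%R by rewrite kp -hg g1 act1.
  move/(_ ord0 ord_max); rewrite !vec0 !eE eqxx.
  by rewrite (_ : (ord_max == ord0 :> 'I_n.+1) = false) // -val_eqE /=; lia.
rewrite hg -kp; apply: (chart_adj ck); apply/near_add0 => r s; rewrite !vec0 !eE.
by case: (r == _); case: (s == _).
Qed.

Lemma gens_generate : 0 < n -> semigroup_generators gens.
Proof.
move=> n0 g; have [[|x u] [uA us] <-] := normal_words_onto g; last by exists (x :: u).
have [a aA] := gens_nonempty n0; exists [:: a; a^-1%g]; split=> //=; first by rewrite aA gensV.
by rewrite /eval !big_cons !big_nil mulg1 mulgV.
Qed.

Lemma normal_words_automatic : automatic_structure gens normal_words.
Proof.
split; [exact: regular_sorted | exact: normal_words_onto |].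
exists 5 => u v Lu Lv uv t.
have Duv : D [set act (eval u) o; act (eval v) o].
  case: uv => [->|[a /gensP [_ Da] ->]]; first exact: D_refl.
  by rewrite actM; exact: act_simplex.
have [k [p [q [q' [ck kp kq kq']]]]] := ex_chart o Duv.
rewrite -(mul1g (prefix_eval v t)).
apply: (normal_words_fellow (p := p) (p' := p) (q := q) (q' := q') ck) => //.
- by rewrite act1.
- by rewrite mul1g.
- by move=> r s; lia.
- by apply: (chart_near ck); rewrite kq kq'.
Qed.

Lemma normal_words_biautomatic : biautomatic_structure gens normal_words.
Proof.
split; first exact: normal_words_automatic.
exists 5 => u v a Lu Lv /gensP [_ Da] e t.
have [k [q [p [p' [ck kq kp kp']]]]] := ex_chart (act (eval u) o) Da.
apply: (normal_words_fellow (p := p) (p' := p') (q := q) (q' := q) ck) => //.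
- by rewrite -e.
- by apply: (chart_near ck); rewrite kp kp'.
- by move=> r s; lia.
Qed.

End Group.

Theorem mainTheorem4 (n : nat) (hn : 2 <= n)
    (V : Type) (D : set (set V)) (tau : V -> 'I_n.+1)
    (hD : building (@affineA n) D tau)
    (hthick : thick D) (hfin : locally_finite D)
    (G : groupType) (act : G -> V -> V)
    (hact : acts_on D act)
    (htrans : simply_transitive act)
    (hrot : forall g, type_rotating tau (act g)) :
  (exists (A : {fset G}) (L : set (seq G)),
     [/\ semigroup_generators A, inversion_closed A,
         automatic_structure A L, symmetric_language L &
         geodesic_language A L]) /\
  biautomatic G.
Proof.
have ex_chart := building_chart hn hD.
have [o _] := building_nonempty hD.
have [_ [hvert _]] := hD.
have hgen : semigroup_generators (gens D act o).
  by apply: (gens_generate o hvert hfin hact htrans hrot ex_chart); lia.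
have hinv : inversion_closed (gens D act o).
  by move=> a; apply: (gensV hvert hfin hact htrans).
have hbi : biautomatic_structure (gens D act o) (normal_words D tau act o).
  exact: (normal_words_biautomatic o hvert hfin hact htrans hrot ex_chart).
split; last by exists (gens D act o), (normal_words D tau act o).
exists (gens D act o), (normal_words D tau act o); split=> //.
- by case: hbi.
- exact: (normal_words_symmetric hvert hfin hact htrans hrot).
- exact: (normal_words_geodesic hvert hfin hact htrans hrot ex_chart).
Qed.
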